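(* For any bounded-degree regular expander graph $G$, and any constant $\varepsilon > 0$, $t_{\mathsf{cov}}^{\varepsilon\mathsf{TB}}(G) = \Theta(n)$. Precisely: let $\varepsilon\in(0,1]$ be fixed and let $(G_i)_{i\ge1}$ be a sequence of regular graphs with uniformly bounded degrees which is an expander, and let $n_i=|V(G_i)|$. Then there exist constants $c,C>0$ such that $c\,n_i\le t_{\mathsf{cov}}^{\varepsilon\mathsf{TB}}(G_i)\le C\,n_i$ for all sufficiently large $i$.
   Context: All graphs are finite, simple, undirected and connected. For $S\subseteq V$, $\Gamma(S)=\{u:\{u,s\}\in E\text{ for some }s\in S\}$. The vertex expansion of $G$ is $\Psi_G=\min_{S\subseteq V:\,0<|S|/|V|\le1/2}|\Gamma(S)\setminus S|/|S|$. A sequence of regular graphs $(G_i)_{i\ge1}$ is an expander if there is a constant $\psi>0$ with $\Psi_{G_i}\ge\psi$ for all $i$, and $|V(G_i)|\to\infty$. The $\varepsilon$-time-biased random walk ($\varepsilon$-TBRW), $\varepsilon\in[0,1]$, is the following process $(X_t)_{t\ge0}$ on $V(G)$: in each step, independently, with probability $1-\varepsilon$ the walk moves to a uniformly random neighbour of the current vertex, and with probability $\varepsilon$ it moves to a neighbour sampled from a probability distribution on the neighbours chosen by a controller; this distribution may depend on the whole history $X_0,\dots,X_t$. A strategy is a rule specifying these choices. $C_v^{\varepsilon\mathsf{TB}}(G)$ is the expected time for the $\varepsilon$-TBRW to visit every vertex of $G$ when started from $v$, minimized over all strategies, and $t_{\mathsf{cov}}^{\varepsilon\mathsf{TB}}(G)=\max_{v\in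 V}C_v^{\varepsilon\mathsf{TB}}(G)$. *)

(* Defs.v *)
From HB Require Import structures.
From mathcomp Require Import all_boot all_order all_algebra.
From mathcomp Require Import all_classical all_reals all_analysis.

Set Implicit Arguments.
Unset Strict Implicit.
Unset Printing Implicit Defensive.

Import Order.TTheory GRing.Theory Num.Theory.
Import numFieldNormedType.Exports.

Local Open Scope classical_set_scope.
Local Open Scope ring_scope.

Structure graph := Graph {
  vertex :> finType;
  adj : rel vertex;
  adj_sym : symmetric adj;
  adj_irr : irreflexive adj;
  graph_inhabited : (0 < #|vertex|)%N;
  graph_connected : forall x y : vertex, connect adj x y }.

Definition degree (G : graph) (x : G) : nat := #|[pred u : G | adj x u]|.

Definition regular (G : graph) : Prop := exists k, forall x : G, degree x = k.

Definition nbhd (G : graph) (S : {set G}) : {set G} :=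
  [set u | [exists s in S, adj u s]].

(* Extended-real valued only because the one-vertex graph has no admissible S;
   its vertex expansion is then +oo. *)
Definition vertex_expansion (R : realType) (G : graph) : \bar R :=
  \big[mine/+oo%E]_(S : {set G}
      | (0 < #|S|%:R / #|G|%:R :> R) && (#|S|%:R / #|G|%:R <= 2^-1 :> R))
    (#|nbhd S :\: S|%:R / #|S|%:R)%:E.

Definition expander (R : realType) (G : nat -> graph) : Prop :=
  (exists2 psi : R, 0 < psi
     & forall i, (psi%:E <= vertex_expansion R (G i))%E)
  /\ #|G i| @[i --> \oo] --> \oo.

(* [sigma (rcons h x)] is the law chosen by the controller when the history is
   [X_0; ...; X_t] = rcons h x, so that the current vertex is x. *)
Definition strategy (R : realType) (G : graph) (sigma : seq G -> G -> R)
    : Prop :=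
  forall (h : seq G) (x : G),
    [/\ forall u, 0 <= sigma (rcons h x) u,
        forall u, ~~ adj x u -> sigma (rcons h x) u = 0
      & \sum_(u : G) sigma (rcons h x) u = 1].

Definition tb_step (R : realType) (G : graph) (eps : R)
    (sigma : seq G -> G -> R) (h : seq G) (x u : G) : R :=
  (1 - eps) * ((adj x u)%:R / (degree x)%:R) + eps * sigma h u.

(* The last clause says that, given X_0 = x_0, ..., X_t = x_t, the law of
   X_{t+1} is [tb_step]; the product form also covers null histories. *)
Definition is_TBRW (R : realType) (G : graph) (eps : R)
    (sigma : seq G -> G -> R) (v : G) (d : measure_display)
    (T : measurableType d) (P : probability T R) (X : nat -> T -> G) : Prop :=
  [/\ forall t u, measurable [set w | X t w = u],
      P [set w | X 0%N w = v] = 1%E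
    & forall (t : nat) (x : nat -> G),
        P [set w | forall i, (i <= t.+1)%N -> X i w = x i] =
        (P [set w | forall i, (i <= t)%N -> X i w = x i] *
         (tb_step eps sigma (mkseq x t.+1) (x t) (x t.+1))%:E)%E].

(* ereal_inf set0 = +oo, so this is +oo on trajectories that never cover G. *)
Definition cover_time (R : realType) (G : graph) (T : Type)
    (X : nat -> T -> G) (w : T) : \bar R :=
  ereal_inf [set (t%:R : R)%:E | t in
    [set t : nat | forall u : G, exists2 s, (s <= t)%N & X s w = u]].

(* The infimum ranges over strategies together with all realizations of the
   walk; the expected cover time depends only on the strategy, since
   [is_TBRW] determines the law of the process. *)
Definition tb_cover_from (R : realType) (eps : R) (G : graph) (v : G)
    : \bar R :=
  ereal_inf [set c : \bar R |
    exists (sigma : seq G -> G -> R) (d : measure_display)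
           (T : measurableType d) (P : probability T R) (X : nat -> T -> G),
      [/\ strategy sigma, is_TBRW eps sigma v P X
        & c = (\int[P]_w cover_time R X w)%E]].

Definition tb_cover (R : realType) (eps : R) (G : graph) : \bar R :=
  \big[maxe/-oo%E]_(v : G) tb_cover_from eps v.

(* Main.v *)
Require Import Defs.
From HB Require Import structures.
From mathcomp Require Import all_boot all_order all_algebra.
From mathcomp Require Import all_classical all_reals all_analysis.
From mathcomp Require Import measurable_realfun.
From mathcomp Require Import ring lra zify.

(** The lower bound holds because a walk sees at most one new vertex per step.

    For the upper bound, let L be the lazy random walk operator, n the number of
    vertices and P its simple random walk average. Vertex expansion and bounded
    degree give, by Cheeger's inequality, an L2 contraction factor mu < 1 for L
    on functions of mean zero, uniform over the sequence (cheeger,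
    lazy_contract); laziness is only a device of the analysis.

    The controller's gain is one inequality (boost): if he steers to the
    neighbour where z is largest, the expectation of z^a after one step is at
    least (P z)^a, where a = 1 - eps/2. So powers of functions which grow under
    P grow under the biased walk, and a target of density 1/rho, which the
    simple walk hits at rate 1/rho, is hit at rate about rho^(-a). For a target
    U of density 1/rho take for z the Green function of L from U, killed at a
    small rate: off U it grows by a constant factor, and at all but a small
    fraction of the vertices it is at least 1/rho up to a small power of rho
    (few_far). At the exceptional vertices the walk need not be steered: there the
    logarithm of a Lyapunov function g with total mass O(n) decreases
    (log_lyapunov). A combination of z^a and ln g is a potential bounding the
    expected hitting time of U (hit_potential_drift), and its sum over any #|U|
    vertices is at most K * #|U| * rho^b for some b < 1 (hitting_potential).

    To cover the graph, always head for the set U of unvisited vertices. The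
    hitting time may be of order ln n from an unlucky vertex, so the worst case
    cannot be paid at each discovery. But hitting bounds are monotone in the
    target: in any order of discovery, those met while the last half of the
    vertices is unvisited are at most the bounds for hitting that half, and their
    sum over the first half of the order is controlled by hitting_potential.
    Halving repeatedly gives O(n) for every order of discovery (cost_le), and
    the hitting bound of U plus the worst remaining cost is a potential that
    decreases by one per step until U is empty (cover_potential_drift).

    The expected cover time is the sum over t of the probability that some
    vertex is unvisited at time t; that potential bounds it for the strategy that
    follows it, by a supermartingale argument (expected_cover_time_le). A walk
    with a given strategy exists on the unit interval, cut successively in
    proportion to the transition probabilities (realization). *)

Import Order.TTheory GRing.Theory Num.Theory.
Import numFieldNormedType.Exports.

Local Open Scope ring_scope.

Set Implicit Arguments.
Unset Strict Implicit.
Unset Printing Implicit Defensive.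

(** * Averaging over neighbours *)

Section Averaging.
Context {R : realType} {G : graph}.
Implicit Types (f g : G -> R) (x u : G).

Definition avg f x : R := (\sum_(u | adj x u) f u) / (degree x)%:R.

Definition lazy f x : R := (f x + avg f x) / 2.

Lemma sum_adj_const x (c : R) : \sum_(u | adj x u) c = (degree x)%:R * c.
Proof. by rewrite sumr_const mulr_natl. Qed.

Lemma avgE f x : avg f x = \sum_u (adj x u)%:R / (degree x)%:R * f u.
Proof.
rewrite /avg mulr_suml big_mkcond; apply: eq_bigr => u _.
by case: (adj x u); rewrite ?mul0r // mul1r mulrC.
Qed.

Lemma avgD f g x : avg (fun u => f u + g u) x = avg f x + avg g x.
Proof. by rewrite /avg big_split mulrDl. Qed.

Lemma avgN f x : avg (fun u => - f u) x = - avg f x.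
Proof. by rewrite /avg sumrN mulNr. Qed.

Lemma avgZ c f x : avg (fun u => c * f u) x = c * avg f x.
Proof. by rewrite /avg -mulr_sumr mulrA. Qed.

Lemma le_avg f g x : (forall u, adj x u -> f u <= g u) -> avg f x <= avg g x.
Proof. by move=> fg; rewrite ler_wpM2r // ler_sum. Qed.

Lemma avg_ge0 f x : (forall u, 0 <= f u) -> 0 <= avg f x.
Proof. by move=> f0; rewrite divr_ge0 // sumr_ge0. Qed.

Lemma lazyD f g x : lazy (fun u => f u + g u) x = lazy f x + lazy g x.
Proof. by rewrite /lazy avgD; field. Qed.

Lemma lazyZ c f x : lazy (fun u => c * f u) x = c * lazy f x.
Proof. by rewrite /lazy avgZ; field. Qed.

Lemma le_lazy f g x : (forall u, f u <= g u) -> lazy f x <= lazy g x.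
Proof. by move=> fg; rewrite ler_pM2r // lerD // le_avg. Qed.

Lemma lazy_ge0 f x : (forall u, 0 <= f u) -> 0 <= lazy f x.
Proof. by move=> f0; rewrite divr_ge0 // addr_ge0 // avg_ge0. Qed.

Lemma eq_lazy f g : f =1 g -> lazy f =1 lazy g.
Proof.
move=> fg x; rewrite /lazy fg; congr ((_ + _ / _) / _).
by apply: eq_bigr => u _; rewrite fg.
Qed.

Lemma lazy_sum (I : finType) (F : I -> G -> R) x :
  lazy (fun u => \sum_i F i u) x = \sum_i lazy (F i) x.
Proof.
rewrite /lazy /avg -mulr_suml big_split -mulr_suml exchange_big.
by congr ((_ + _ / _) / _).
Qed.

End Averaging.

Section Regular.
Context {R : realType} {G : graph} {k : nat}.
Hypotheses (degG : forall x : G, degree x = k) (k_gt0 : (0 < k)%N).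
Implicit Types (f g : G -> R) (x u : G) (S : {set G}) (c psi : R).

Let k0 : 0 < k%:R :> R. Proof. by rewrite ltr0n. Qed.
Let kn0 : k%:R != 0 :> R. Proof. by rewrite gt_eqF. Qed.

Lemma avg_const c x : avg (fun _ : G => c) x = c.
Proof. by rewrite /avg sum_adj_const degG mulrAC divff // mul1r. Qed.

Lemma lazy_const c x : lazy (fun _ : G => c) x = c.
Proof. by rewrite /lazy avg_const; field. Qed.

Lemma sum_adjC (F : G -> G -> R) :
  \sum_x \sum_(u | adj x u) F x u = \sum_x \sum_(u | adj x u) F u x.
Proof.
rewrite (exchange_big_dep xpredT) //=.
by apply: eq_bigr => x _; apply: eq_bigl => u; rewrite adj_sym.
Qed.

Lemma sum_avg_mul f g : \sum_x avg f x * g x = \sum_x f x * avg g x.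
Proof.
have E (f1 g1 : G -> R) : \sum_x f1 x * avg g1 x
    = (\sum_x \sum_(u | adj x u) f1 x * g1 u) / k%:R.
  rewrite mulr_suml; apply: eq_bigr => x _.
  by rewrite /avg degG mulrA mulr_sumr.
transitivity (\sum_x g x * avg f x).
  by apply: eq_bigr => x _; rewrite mulrC.
rewrite !E sum_adjC; congr (_ / _).
by apply: eq_bigr => x _; apply: eq_bigr => u _; rewrite mulrC.
Qed.

Lemma sum_avg f : \sum_x avg f x = \sum_x f x.
Proof.
have := sum_avg_mul f (fun=> 1).
under eq_bigr do rewrite mulr1.
by under [in RHS]eq_bigr do rewrite avg_const mulr1.
Qed.

Lemma sum_lazy f : \sum_x lazy f x = \sum_x f x.
Proof. by rewrite -mulr_suml big_split sum_avg /=; field. Qed.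

Lemma avg_sqr_le f x : avg f x ^+ 2 <= avg (fun u => f u ^+ 2) x.
Proof.
rewrite -subr_ge0.
have -> : avg (fun u => f u ^+ 2) x - avg f x ^+ 2
        = avg (fun u => (f u - avg f x) ^+ 2) x.
  set a := avg f x.
  transitivity (avg (fun u => f u ^+ 2 + (- (2 * a) * f u + a ^+ 2)) x).
    by rewrite avgD avgD avgZ avg_const -/a; ring.
  by congr (_ / _); apply: eq_bigr => u _; ring.
by apply: avg_ge0 => u; exact: sqr_ge0.
Qed.

Lemma sum_avg_sqr_le f : \sum_x avg f x ^+ 2 <= \sum_x f x ^+ 2.
Proof.
rewrite -[leRHS]sum_avg; apply: ler_sum => x _; exact: avg_sqr_le.
Qed.

(** * From vertex expansion to a spectral gap *)

Definition edge_energy f : R := \sum_x \sum_(u | adj x u) (f x - f u) ^+ 2.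

Lemma edge_energyE f :
  edge_energy f = 2 * k%:R * \sum_x f x * (f x - avg f x).
Proof.
have E x : \sum_(u | adj x u) (f x - f u) ^+ 2
  = k%:R * f x ^+ 2 - 2 * k%:R * (f x * avg f x) + \sum_(u | adj x u) f u ^+ 2.
  rewrite -(degG x) -sum_adj_const /avg degG.
  have -> : 2 * k%:R * (f x * ((\sum_(u | adj x u) f u) / k%:R))
          = \sum_(u | adj x u) 2 * f x * f u.
    by rewrite -mulr_sumr; field.
  by rewrite -sumrB -big_split; apply: eq_bigr => u _ /=; ring.
rewrite /edge_energy (eq_bigr _ (fun x _ => E x)) big_split /=.
have -> : \sum_x \sum_(u | adj x u) f u ^+ 2 = \sum_x k%:R * f x ^+ 2.
  rewrite (sum_adjC (fun _ u => f u ^+ 2)); apply: eq_bigr => x _.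
  by rewrite sum_adj_const degG.
rewrite -big_split mulr_sumr; apply: eq_bigr => x _ /=; ring.
Qed.

(** The bound psi on the vertex expansion, in a form that needs neither division
    nor a convention for the one-vertex graph. *)
Definition expanding psi := forall S : {set G}, (0 < #|S|)%N ->
  (#|S|.*2 <= #|G|)%N -> psi * #|S|%:R <= #|nbhd S :\: S|%:R.

(** Each boundary vertex carries at least one edge leaving S, which the double
    sum counts in both directions. *)
Lemma indic_boundary psi S : expanding psi -> (0 < #|S|)%N ->
  (#|S|.*2 <= #|G|)%N ->
  2 * psi * #|S|%:R
    <= \sum_x \sum_(u | adj x u) `|(x \in S)%:R - (u \in S)%:R : R|.
Proof.
move=> exp S0 S2.
pose out x u : R := (adj x u && (x \notin S) && (u \in S))%:R.
have E x u : adj x u -> `|(x \in S)%:R - (u \in S)%:R : R| = out x u + out u x.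
  rewrite /out (adj_sym u x) => -> /=; case: (x \in S); case: (u \in S);
  by rewrite /= ?subrr ?normr0 ?subr0 ?sub0r ?normrN ?normr1 ?addr0 ?add0r.
have -> : \sum_x \sum_(u | adj x u) `|(x \in S)%:R - (u \in S)%:R : R|
        = 2 * \sum_x \sum_(u | adj x u) out x u.
  under eq_bigr => x _ do under eq_bigr => u xu do rewrite E //.
  under eq_bigr => x _ do rewrite big_split /=.
  by rewrite big_split /= -(sum_adjC out) mulr_natl mulr2n.
rewrite -mulrA ler_pM2l //; apply: le_trans (exp _ S0 S2) _.
rewrite -sum1_card natr_sum big_mkcond; apply: ler_sum => x _ /=.
case: ifP => [|_]; last by apply: sumr_ge0 => u _; exact: ler0n.
rewrite finset.in_setD inE => /andP[xS /existsP[u /andP[uS xu]]].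
rewrite (bigD1 u) //= /out xu xS uS /= lerDl.
by apply: sumr_ge0 => w _; exact: ler0n.
Qed.

(** The co-area argument: peel off the smallest positive level of f, which is a
    multiple of the indicator of the support, and recurse on the rest. *)
Lemma coarea psi f : expanding psi -> (forall x, 0 <= f x) ->
  (#|[set x | f x != 0%R]|.*2 <= #|G|)%N ->
  2 * psi * \sum_x f x <= \sum_x \sum_(u | adj x u) `|f x - f u|.
Proof.
move=> exp; have [m] := ubnP #|[set x | f x != 0%R]|.
elim: m f => // m IHm f; rewrite ltnS => fm f0.
set S := [set x | f x != 0%R] in fm * => S2.
have [S0|] := posnP #|S|.
  rewrite big1 ?mulr0; last first.
    have /eqP SE : S == finset.set0 by rewrite -cards_eq0 S0.
    move=> x _; apply/eqP; apply: contraT => xS.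
    have : x \in S by rewrite inE.
    by rewrite SE inE.
  by apply: sumr_ge0 => x _; apply: sumr_ge0 => u _.
move=> S0; have /card_gt0P[s0 s0S] := S0.
pose s := [arg min_(s < s0 in S) f s]%O.
have [sS smin] : s \in S /\ forall x, x \in S -> f s <= f x.
  by rewrite /s; case: arg_minP.
clearbody s.
have fs0 : 0 < f s by move: sS; rewrite /S finset.in_set lt_def f0 andbT.
have fsW := ltW fs0.
pose g x := f x - f s * (x \in S)%:R.
have fE x : f x = g x + f s * (x \in S)%:R by rewrite /g subrK.
have g0 x : 0 <= g x.
  rewrite /g subr_ge0; case: (boolP (x \in S)) => xS; rewrite ?mulr1 ?mulr0 //.
  exact: smin.
have gS x : x \notin S -> g x = 0.
  move=> xS; rewrite /g (negbTE xS) mulr0 subr0.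
  by apply/eqP; apply: contraNT xS; rewrite inE.
have gsub : [set x | g x != 0] \subset S :\ s.
  apply/fintype.subsetP => x; rewrite inE in_setD1 => gx; apply/andP; split.
    by apply: contraNneq gx => ->; rewrite /g sS mulr1 subrr.
  by apply: contraNT gx => /gS ->.
have cardS : #|S| = #|S :\ s|.+1 by rewrite (cardsD1 s S) sS.
have gm : (#|[set x | g x != 0%R]| < m)%N.
  by apply: leq_trans fm; rewrite cardS ltnS subset_leq_card.
have g2 : (#|[set x | g x != 0%R]|.*2 <= #|G|)%N.
  apply: leq_trans S2; rewrite leq_double cardS.
  exact: leqW (subset_leq_card gsub).
have IH := IHm g gm g0 g2; clearbody g.
have -> : \sum_x f x = \sum_x g x + f s * #|S|%:R.
  rewrite (eq_bigr _ (fun x _ => fE x)) big_split /= -mulr_sumr.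
  congr (_ + _ * _); rewrite -natr_sum -sum1_card [in RHS]big_mkcond.
  by congr (_%:R); apply: eq_bigr => x _; case: (x \in S).
have -> : \sum_x \sum_(u | adj x u) `|f x - f u|
  = \sum_x \sum_(u | adj x u) `|g x - g u|
    + f s * \sum_x \sum_(u | adj x u) `|(x \in S)%:R - (u \in S)%:R : R|.
  rewrite mulr_sumr -big_split; apply: eq_bigr => x _ /=.
  rewrite mulr_sumr -big_split; apply: eq_bigr => u _ /=.
  rewrite (fE x) (fE u).
  case: (boolP (x \in S)) => xS; case: (boolP (u \in S)) => uS;
    rewrite ?(gS _ xS) ?(gS _ uS) /=.
  - by rewrite subrr normr0 mulr0 addr0; congr `|_|; ring.
  - by rewrite mulr0 addr0 !subr0 normr1 !mulr1 !ger0_norm // ?addr_ge0.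
  - rewrite mulr0 mulr1 addr0 !sub0r !normrN normr1 mulr1.
    by rewrite !ger0_norm // ?addr_ge0.
  - by rewrite !subrr normr0 mulr0 addr0.
rewrite mulrDr lerD // mulrCA ler_pM2l //.
exact: indic_boundary.
Qed.

(** Cheeger's inequality on a small support: the co-area bound for f ^ 2, with
    |a^2 - b^2| split by the weighted AM-GM inequality. *)
Lemma cheeger_half psi f : 0 < psi -> expanding psi -> (forall x, 0 <= f x) ->
  (#|[set x | f x != 0%R]|.*2 <= #|G|)%N ->
  psi ^+ 2 / k%:R * \sum_x f x ^+ 2 <= edge_energy f.
Proof.
move=> psi0 exp f0 f2.
have := @coarea psi (fun x => f x ^+ 2) exp (fun x => sqr_ge0 _).
have -> : [set x | f x ^+ 2 != 0] = [set x | f x != 0].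
  by apply/setP => x; rewrite !inE expf_eq0.
move=> /(_ f2) co.
set Q := \sum_x f x ^+ 2 in co *.
(* The AM-GM weight is chosen so that the term in (f x + f u)^2 is at most half
   of the left-hand side of co. *)
have bnd : \sum_x \sum_(u | adj x u) `|f x ^+ 2 - f u ^+ 2|
   <= k%:R / psi * edge_energy f + psi / (4 * k%:R) * (4 * k%:R * Q).
  have -> : 4 * k%:R * Q
      = \sum_x \sum_(u | adj x u) 2 * (f x ^+ 2 + f u ^+ 2).
    under eq_bigr do rewrite -mulr_sumr big_split /=.
    rewrite -mulr_sumr big_split /= (sum_adjC (fun _ u => f u ^+ 2)).
    under eq_bigr do rewrite sum_adj_const degG.
    by rewrite -mulr_sumr -/Q; ring.
  rewrite /edge_energy !mulr_sumr -big_split; apply: ler_sum => x _ /=.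
  rewrite !mulr_sumr -big_split; apply: ler_sum => u _ /=.
  have -> : f x ^+ 2 - f u ^+ 2 = (f x - f u) * (f x + f u) by ring.
  rewrite normrM -[(f x - f u) ^+ 2]real_normK ?num_real //.
  set a := `|f x - f u|; set b := `|f x + f u|.
  have b2 : b ^+ 2 <= 2 * (f x ^+ 2 + f u ^+ 2).
    rewrite real_normK ?num_real // -subr_ge0.
    have -> : 2 * (f x ^+ 2 + f u ^+ 2) - (f x + f u) ^+ 2 = (f x - f u) ^+ 2.
      by ring.
    exact: sqr_ge0.
  have p4 : 0 <= psi / (4 * k%:R) by rewrite divr_ge0 ?mulr_ge0 // ltW.
  apply: le_trans (lerD (lexx _) (ler_wpM2l p4 b2)).
  rewrite -subr_ge0.
  have -> : k%:R / psi * a ^+ 2 + psi / (4 * k%:R) * b ^+ 2 - a * b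
       = k%:R / psi * (a - psi / (2 * k%:R) * b) ^+ 2.
    by field; rewrite kn0 gt_eqF.
  by rewrite mulr_ge0 ?sqr_ge0 // divr_ge0 // ltW.
have {co}bnd := le_trans co bnd.
have {}bnd : psi * Q <= k%:R / psi * edge_energy f.
  have E : psi / (4 * k%:R) * (4 * k%:R * Q) = psi * Q by field.
  by rewrite E in bnd; lra.
have pk : 0 < psi / k%:R by rewrite divr_gt0.
have := ler_wpM2l (ltW pk) bnd.
have -> : psi / k%:R * (psi * Q) = psi ^+ 2 / k%:R * Q by ring.
suff -> : psi / k%:R * (k%:R / psi * edge_energy f) = edge_energy f by [].
by field; rewrite kn0 gt_eqF.
Qed.

(** Both f above c and f below c then live on at most half of the vertices, where
    expansion applies. *)
Lemma median f : exists c, (#|[set x | (c < f x)%R]|.*2 <= #|G|)%N /\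
  (#|[set x | (f x < c)%R]|.*2 <= #|G|)%N.
Proof.
have /card_gt0P[x0 _] := graph_inhabited G.
pose ok x := (#|[set y | (f x < f y)%R]|.*2 <= #|G|)%N.
pose M := [arg max_(y > x0) f y]%O.
have Mmax y : f y <= f M.
  by rewrite /M; case: arg_maxP => // i _ /(_ y); exact.
have okM : ok M.
  rewrite /ok (_ : [set y | _] = finset.set0) ?cards0 //.
  by apply/setP => y; rewrite !inE ltNge Mmax.
pose c := [arg min_(y < M | ok y) f y]%O.
have [okc cmin] : ok c /\ forall y, ok y -> f c <= f y.
  by rewrite /c; case: arg_minP.
clearbody c.
exists (f c); split; first exact: okc.
rewrite leqNgt; apply/negP => big.
set L := [set x | f x < f c] in big.
have /card_gt0P[y0 y0L] : (0 < #|L|)%N.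
  by rewrite lt0n; apply: contraTneq big => ->.
pose z := [arg max_(y > y0 in L) f y]%O.
have [zL zmax] : z \in L /\ forall y, y \in L -> f y <= f z.
  by rewrite /z; case: arg_maxP.
clearbody z.
have /cmin : ok z.
  have sub : [set y | f z < f y] \subset ~: L.
    apply/fintype.subsetP => y; rewrite !inE => zy; apply/negP => yc.
    by move: zy; rewrite ltNge zmax // inE.
  have := subset_leq_card sub; have := cardsC L; rewrite /ok => e le1.
  rewrite -(leq_add2l #|L|.*2) -doubleD.
  apply: (@leq_trans (#|G|.*2)); first by rewrite -e leq_double leq_add2l.
  by rewrite -addnn leq_add2r ltnW.
by rewrite leNgt; move: zL; rewrite inE => ->.
Qed.

(** The parts of f above and below a median c are treated separately; replacing
    the mean 0 of f by c only increases the sum of squares. *)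
Lemma cheeger psi f : 0 < psi -> expanding psi -> \sum_x f x = 0 ->
  psi ^+ 2 / k%:R * \sum_x f x ^+ 2 <= edge_energy f.
Proof.
move=> psi0 exp f0; have [c [cgt clt]] := median f.
pose p x := Num.max (f x - c) 0; pose q x := Num.max (c - f x) 0.
have pq x : f x - c = p x - q x.
  by rewrite /p /q /Num.max; do 2![case: ifP]; lra.
have p0 x : 0 <= p x by rewrite le_max lexx orbT.
have q0 x : 0 <= q x by rewrite le_max lexx orbT.
have pqx x : p x * q x = 0.
  rewrite /p /q /Num.max; case: ifP => [|h1]; first by rewrite mul0r.
  by case: ifP => [|h2]; [rewrite mulr0 | nra].
have hp := @cheeger_half psi p psi0 exp p0.
have hq := @cheeger_half psi q psi0 exp q0.
have {}hp : psi ^+ 2 / k%:R * \sum_x p x ^+ 2 <= edge_energy p.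
  apply: hp; apply: leq_trans cgt; rewrite leq_double; apply: subset_leq_card.
  apply/fintype.subsetP => x; rewrite !inE; apply: contraNT; rewrite -leNgt => fx.
  by rewrite /p max_r // subr_le0.
have {}hq : psi ^+ 2 / k%:R * \sum_x q x ^+ 2 <= edge_energy q.
  apply: hq; apply: leq_trans clt; rewrite leq_double; apply: subset_leq_card.
  apply/fintype.subsetP => x; rewrite !inE; apply: contraNT; rewrite -leNgt => fx.
  by rewrite /q max_r // subr_le0.
have E : edge_energy p + edge_energy q <= edge_energy f.
  rewrite -big_split; apply: ler_sum => x _; rewrite -big_split.
  apply: ler_sum => u _ /=.
  have -> : f x - f u = (p x - q x) - (p u - q u) by rewrite -!pq; ring.
  rewrite -subr_ge0.
  have -> : (p x - q x - (p u - q u)) ^+ 2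
     - ((p x - p u) ^+ 2 + (q x - q u) ^+ 2)
     = 2 * (p x * q u + p u * q x) - 2 * (p x * q x) - 2 * (p u * q u) by ring.
  by rewrite !pqx !mulr0 !subr0 mulr_ge0 // addr_ge0 // mulr_ge0.
apply: le_trans E; apply: le_trans (lerD hp hq).
rewrite -mulrDr; apply: ler_wpM2l; first by rewrite divr_ge0 ?sqr_ge0.
have -> : \sum_x p x ^+ 2 + \sum_x q x ^+ 2 = \sum_x (f x - c) ^+ 2.
  rewrite -big_split; apply: eq_bigr => x _ /=.
  by rewrite pq; have := pqx x => h; ring: h.
have -> : \sum_x (f x - c) ^+ 2
    = \sum_x f x ^+ 2 - 2 * c * \sum_x f x + \sum_(x : G) c ^+ 2.
  by rewrite mulr_sumr -sumrB -big_split; apply: eq_bigr => x _ /=; ring.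
by rewrite f0 mulr0 subr0 lerDl sumr_ge0 // => x _; exact: sqr_ge0.
Qed.

(** Laziness makes the walk insensitive to bipartite-like behaviour: only the
    upper end of the spectrum, controlled by expansion, matters. *)
Lemma lazy_contract psi f : 0 < psi -> expanding psi -> \sum_x f x = 0 ->
  \sum_x lazy f x ^+ 2 <= (1 - psi ^+ 2 / (4 * k%:R ^+ 2)) * \sum_x f x ^+ 2.
Proof.
move=> psi0 exp f0.
have ch := cheeger psi0 exp f0; rewrite edge_energyE in ch.
set Q := \sum_x f x ^+ 2 in ch *.
have {}ch : psi ^+ 2 / (4 * k%:R ^+ 2) * Q
    <= 2^-1 * \sum_x f x * (f x - avg f x).
  have p4 : 0 <= (4 * k%:R)^-1 :> R by rewrite invr_ge0 mulr_ge0.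
  have := ler_wpM2l p4 ch.
  set W := \sum_x f x * (f x - avg f x).
  have -> : (4 * k%:R)^-1 * (psi ^+ 2 / k%:R * Q) = psi ^+ 2 / (4 * k%:R ^+ 2) * Q.
    by field.
  by have -> : (4 * k%:R)^-1 * (2 * k%:R * W) = 2^-1 * W by field.
have E : \sum_x f x * (f x - avg f x) = Q - \sum_x f x * avg f x.
  by rewrite -sumrB; apply: eq_bigr => x _; ring.
rewrite E in ch.
have -> : \sum_x lazy f x ^+ 2
   = 4^-1 * (Q + 2 * \sum_x f x * avg f x + \sum_x avg f x ^+ 2).
  rewrite mulr_sumr -!big_split mulr_sumr; apply: eq_bigr => x _.
  by rewrite /lazy /=; field.
have := sum_avg_sqr_le f; rewrite -/Q mulrBl mul1r; lra.
Qed.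

End Regular.

(** * A Lyapunov function for small sets *)

(** This L2 contraction off the constants is the form in which expansion enters
    the analysis of the walk. *)
Definition contracts (R : realType) (G : graph) (mu : R) :=
  forall f : G -> R, \sum_x f x = 0 ->
    \sum_x lazy f x ^+ 2 <= mu * \sum_x f x ^+ 2.

Section RealLemmas.
Context {R : realType}.

Lemma sum_geometric_le (r : R) (J : nat) : 0 <= r -> r < 1 ->
  \sum_(j < J) r ^+ j <= (1 - r)^-1.
Proof.
move=> r0 r1; have r1' : 0 < 1 - r by rewrite subr_gt0.
rewrite -[leRHS]mul1r ler_pdivlMr // mulrC.
have -> : (1 - r) * \sum_(j < J) r ^+ j = 1 - r ^+ J.
  by rewrite -opprB mulNr -subrX1 opprB.
by rewrite gerBl exprn_ge0.
Qed.

Lemma expr_small (r e : R) : 0 <= r -> r < 1 -> 0 < e -> exists J, r ^+ J <= e.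
Proof.
move=> r0 r1 e0.
have : (r ^+ n @[n --> \oo] --> (0 : R))%classic.
  by apply: cvg_expr; rewrite ger0_norm.
move=> /cvgr0_norm_le /(_ _ e0) [J _ /(_ J (leqnn J))] /=.
by rewrite ger0_norm ?exprn_ge0 // => h; exists J.
Qed.

Lemma weighted_cauchy (I : finType) (f D : I -> R) : (forall x, 0 < D x) ->
  (\sum_x f x) ^+ 2 <= (\sum_x f x ^+ 2 / D x) * \sum_x D x.
Proof.
move=> D0; have S0 : 0 <= \sum_x D x by rewrite sumr_ge0 // => x _; exact: ltW.
set S := \sum_x D x in S0 *; set F := \sum_x f x; set N := \sum_x _.
have [Sp|] := ltP 0 S; last first.
  move=> Sn; have S_eq : S = 0 by apply: le_anti; rewrite S0 Sn.
  have /eqP := S_eq; rewrite psumr_eq0; last by move=> x _; exact: ltW.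
  move=> /allP h.
  suff -> : F = 0 by rewrite S_eq expr0n mulr0.
  apply: big1 => x _; have := h x (mem_index_enum x).
  by rewrite gt_eqF.
have : 0 <= \sum_x (f x - F / S * D x) ^+ 2 / D x.
  by apply: sumr_ge0 => x _; rewrite divr_ge0 ?sqr_ge0 // ltW.
have -> : \sum_x (f x - F / S * D x) ^+ 2 / D x
   = N - 2 * (F / S) * F + (F / S) ^+ 2 * S.
  rewrite /N [in RHS]/S (_ : 2 * (F / S) * F = \sum_x 2 * (F / S) * f x).
    rewrite mulr_sumr -sumrB -big_split; apply: eq_bigr => x _ /=.
    by rewrite -/S; field; rewrite !gt_eqF.
  by rewrite -mulr_sumr.
have -> : N - 2 * (F / S) * F + (F / S) ^+ 2 * S = (N * S - F ^+ 2) / S.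
  by field; rewrite gt_eqF.
by rewrite pmulr_lge0 ?invr_gt0 // subr_ge0.
Qed.

Lemma ln_le_tangent (x t : R) : 0 < x -> 0 < t -> ln x <= ln t + (x / t - 1).
Proof.
move=> x0 t0; rewrite -lerBlDl -ln_div ?posrE //.
have := @le_ln1Dx R (x / t - 1).
by rewrite (addrC 1) subrK ltrBrDr addNr divr_gt0 //; apply.
Qed.

End RealLemmas.

Section Lyapunov.
Context {R : realType} {G : graph} {k : nat} {mu : R}.
Hypotheses (degG : forall x : G, degree x = k) (k_gt0 : (0 < k)%N).
Hypotheses (mu_gt0 : 0 < mu) (mu_lt1 : mu < 1) (gapG : contracts G mu).
Implicit Types (f : G -> R) (x u : G) (B : {set G}).

Let eta : R := 1 - mu.
Let alpha : R := 1 - eta / 8.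
Let kap : R := eta / 16.

Let eta_gt0 : 0 < eta. Proof. by rewrite subr_gt0. Qed.
Let eta_lt1 : eta < 1. Proof. by rewrite gtrBl. Qed.
Let alpha_gt : 7 / 8 < alpha.
Proof. by move: eta_gt0 eta_lt1; rewrite /alpha; lra. Qed.
Let alpha_gt0 : 0 < alpha. Proof. by move: alpha_gt; lra. Qed.
Let alpha_lt1 : alpha < 1. Proof. by move: eta_gt0 eta_lt1; rewrite /alpha; lra. Qed.
Let kap_gt0 : 0 < kap. Proof. by rewrite /kap divr_gt0. Qed.

Variable B : {set G}.
Hypothesis B_small : #|B|%:R <= eta / 16 * #|G|%:R.

(* The operator M is lazy averaging, amplified on B by slightly more than 1 and
   strongly damped elsewhere. As B is small, M still contracts the weighted norm
   N: its action on constants is small because D is small on average, and on the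
   rest the spectral gap beats the amplification. *)
Let D x : R := if x \in B then alpha^-1 else kap.
Let M f x : R := D x * lazy f x.
Let N f : R := \sum_x f x ^+ 2 / D x.
Let n : R := #|G|%:R.

Let n_gt0 : 0 < n. Proof. by rewrite ltr0n; exact: graph_inhabited. Qed.

Let alphaV : alpha^-1 < 8 / 7.
Proof. by rewrite -[8 / 7]invf_div ltf_pV2 ?posrE // divr_gt0. Qed.

Let alphaV1 : 1 < alpha^-1. Proof. by rewrite invf_gt1. Qed.

Let D_gt0 x : 0 < D x.
Proof. by rewrite /D; case: ifP; rewrite ?invr_gt0. Qed.

Local Ltac clra := move: eta_gt0 eta_lt1 alphaV alphaV1 mu_gt0 mu_lt1; lra.

Let D_le x : D x <= alpha^-1.
Proof. by rewrite /D; case: ifP => // _; rewrite /kap; clra. Qed.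

Let D_ge x : kap <= D x.
Proof. by rewrite /D; case: ifP => // _; rewrite /kap; clra. Qed.

Let sumD : \sum_x D x <= eta / 7 * n.
Proof.
have -> : \sum_x D x = \sum_(x in B) alpha^-1 + \sum_(x | x \notin B) kap.
  rewrite (bigID (mem B)) /=; congr (_ + _); apply: eq_bigr => x xB.
    by rewrite /D xB.
  by rewrite /D (negbTE xB).
rewrite !sumr_const.
have h1 : alpha^-1 *+ #|B| <= 8 / 7 * (eta / 16 * n).
  rewrite -[alpha^-1 *+ _]mulr_natr.
  apply: ler_pM => //; first by rewrite invr_ge0 ltW.
  exact: ltW.
have h2 : kap *+ #|[pred x | x \notin B]| <= kap * n.
  by rewrite -[kap *+ _]mulr_natr ler_pM2l // ler_nat max_card.
apply: le_trans (lerD h1 h2) _.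
have := mulr_gt0 eta_gt0 n_gt0; rewrite /kap; nra.
Qed.

Let M_contract f : N (M f) <= (1 - eta / 4) * N f.
Proof.
have -> : N (M f) = \sum_x D x * lazy f x ^+ 2.
  by apply: eq_bigr => x _; rewrite /M; field; rewrite gt_eqF.
set c := (\sum_x f x) / n.
pose h x := f x - c.
have h0 : \sum_x h x = 0.
  rewrite sumrB sumr_const -mulr_natr -/n /c mulfVK ?subrr //.
  by rewrite gt_eqF.
have lf x : lazy f x = c + lazy h x.
  rewrite -[in RHS](lazy_const degG k_gt0 c x) -lazyD; apply: eq_lazy => u.
  by rewrite /h addrC subrK.
have Nge0 : 0 <= N f.
  by apply: sumr_ge0 => x _; rewrite divr_ge0 ?sqr_ge0 // ltW.
have step1 : \sum_x D x * lazy f x ^+ 2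
  <= (1 + 4 / eta) * (c ^+ 2 * \sum_x D x)
     + (1 + eta / 4) * \sum_x D x * lazy h x ^+ 2.
  rewrite !mulr_sumr -big_split; apply: ler_sum => x _ /=.
  rewrite lf -subr_ge0.
  have -> : (1 + 4 / eta) * (c ^+ 2 * D x)
     + (1 + eta / 4) * (D x * lazy h x ^+ 2) - D x * (c + lazy h x) ^+ 2
     = D x * (4 / eta) * (c - eta / 4 * lazy h x) ^+ 2.
    by field; rewrite gt_eqF.
  by rewrite mulr_ge0 ?sqr_ge0 // mulr_ge0 ?divr_ge0 // ltW.
apply: le_trans step1 _.
have cs := weighted_cauchy f D_gt0; rewrite -/(N f) in cs.
have S0 : 0 <= \sum_x D x by rewrite sumr_ge0 // => x _; exact: ltW.
have b1 : c ^+ 2 * \sum_x D x <= (eta / 7) ^+ 2 * N f.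
  set S := \sum_x D x in cs S0 *.
  have c2 : c ^+ 2 * n ^+ 2 <= N f * S.
    by rewrite -exprMn /c mulfVK // gt_eqF.
  have n2 : 0 < n ^+ 2 by rewrite exprn_gt0.
  rewrite -(ler_pM2r n2).
  apply: (@le_trans _ _ (N f * S * S)).
    by rewrite mulrAC ler_wpM2r.
  have -> : (eta / 7) ^+ 2 * N f * n ^+ 2 = N f * ((eta / 7 * n) ^+ 2) by ring.
  by rewrite -mulrA -expr2 ler_wpM2l // lerXn2r ?nnegrE // (le_trans S0).
have b2 : \sum_x D x * lazy h x ^+ 2 <= alpha^-1 * (mu * (alpha^-1 * N f)).
  apply: (@le_trans _ _ (alpha^-1 * \sum_x lazy h x ^+ 2)).
    by rewrite mulr_sumr; apply: ler_sum => x _; rewrite ler_wpM2r ?sqr_ge0.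
  have aV : 0 < alpha^-1 by rewrite invr_gt0.
  rewrite ler_pM2l //; apply: le_trans (gapG h0) _.
  rewrite ler_pM2l //.
  apply: (@le_trans _ _ (\sum_x f x ^+ 2)).
    have -> : \sum_x h x ^+ 2 = \sum_x f x ^+ 2 - n * c ^+ 2.
      have -> : n * c ^+ 2 = 2 * c * (\sum_x f x) - \sum_(x : G) c ^+ 2.
        by rewrite sumr_const -mulr_natl -/n /c; field; rewrite gt_eqF.
      by rewrite mulr_sumr -!sumrB; apply: eq_bigr => x _; rewrite /h; ring.
    by rewrite gerBl mulr_ge0 ?sqr_ge0 // ltW.
  rewrite /N mulr_sumr; apply: ler_sum => x _.
  rewrite mulrCA ler_peMr ?sqr_ge0 //.
  by rewrite ler_pdivlMr // mul1r.
have e4 : 0 < 1 + 4 / eta by rewrite addr_gt0 // divr_gt0.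
have e5 : 0 < 1 + eta / 4 by rewrite addr_gt0 // divr_gt0.
apply: le_trans (lerD (ler_wpM2l (ltW e4) b1) (ler_wpM2l (ltW e5) b2)) _.
have -> : (1 + 4 / eta) * ((eta / 7) ^+ 2 * N f)
   + (1 + eta / 4) * (alpha^-1 * (mu * (alpha^-1 * N f)))
   = (eta * (eta + 4) / 49 + (1 + eta / 4) * mu / alpha ^+ 2) * N f.
  by field; rewrite ?gt_eqF.
rewrite ler_wpM2r //.
have q2 : (1 + eta / 4) * mu / alpha ^+ 2 <= 1 - eta / 2.
  rewrite ler_pdivrMr ?exprn_gt0 // -[mu](subKr 1) -/eta /alpha.
  rewrite -subr_ge0.
  have -> : (1 - eta / 2) * (1 - eta / 8) ^+ 2 - (1 + eta / 4) * (1 - eta)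
     = eta ^+ 2 * (25 / 64 - eta / 128) by field.
  by rewrite mulr_ge0 ?sqr_ge0 //; clra.
have q1 : eta * (eta + 4) / 49 <= eta / 4.
  by rewrite -mulrA ler_wpM2l ?(ltW eta_gt0) //; clra.
clra.
Qed.

Let one (x : G) : R := 1.
Let Mj j : G -> R := iter j M one.
Let r : R := Num.sqrt (1 - eta / 4).

Let r_ge0 : 0 <= r. Proof. exact: sqrtr_ge0. Qed.
Let r2 : r ^+ 2 = 1 - eta / 4. Proof. by rewrite sqr_sqrtr //; clra. Qed.
Let r_lt1 : r < 1.
Proof. by rewrite -(@expr_lt1 _ 2) // r2; clra. Qed.

Let Mj_ge0 j x : 0 <= Mj j x.
Proof.
elim: j x => [|j IH] x /=; first exact: ler01.
by rewrite mulr_ge0 ?lazy_ge0 // ltW.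
Qed.

Let sumMj j : \sum_x Mj j x <= r ^+ j * (3 * n).
Proof.
have NMj : N (Mj j) <= (1 - eta / 4) ^+ j * (n / kap).
  elim: j => [|j IH].
    rewrite expr0 mul1r /N /Mj /= /one.
    apply: (@le_trans _ _ (\sum_(x : G) kap^-1)).
      apply: ler_sum => x _; rewrite expr1n mul1r lef_pV2 ?posrE //.
    by rewrite sumr_const -mulr_natl.
  rewrite exprS -mulrA; apply: le_trans (M_contract _) _.
  by rewrite ler_wpM2l //; clra.
have h : (\sum_x Mj j x) ^+ 2 <= (r ^+ j * (3 * n)) ^+ 2.
  apply: le_trans (weighted_cauchy _ D_gt0) _.
  rewrite exprMn -exprM mulnC exprM r2.
  have q0 : 0 <= (1 - eta / 4) ^+ j by rewrite exprn_ge0 //; clra.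
  apply: (@le_trans _ _ ((1 - eta / 4) ^+ j * (n / kap) * (eta / 7 * n))).
    apply: ler_pM => //; first by apply: sumr_ge0 => x _;
      rewrite divr_ge0 ?sqr_ge0 // ltW.
    by apply: sumr_ge0 => x _; exact: ltW.
  rewrite -mulrA ler_wpM2l //.
  have -> : n / kap * (eta / 7 * n) = 16 / 7 * n ^+ 2.
    by rewrite /kap; field; rewrite gt_eqF.
  have : 0 < n ^+ 2 by rewrite exprn_gt0.
  rewrite exprMn; nra.
have A0 : 0 <= \sum_x Mj j x by apply: sumr_ge0.
have B0 : 0 <= r ^+ j * (3 * n).
  by rewrite mulr_ge0 ?exprn_ge0 // mulr_ge0 // ltW.
by move: h; rewrite ler_pXn2r // nnegrE.
Qed.

(** The function is the Neumann series of M applied to 1, cut at a rank where the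
    next term is below 1 everywhere, so that M g <= g still holds: on B this is
    the decrease of the average, and elsewhere it bounds the growth to a
    neighbour. *)
Lemma lyapunov_function : exists g : G -> R,
  [/\ forall x, 1 <= g x,
      forall x, x \in B -> avg g x <= (1 - (1 - mu) / 4) * g x,
      forall x u, adj x u -> g u <= 32 * k%:R / (1 - mu) * g x
    & \sum_x g x <= 3 / (1 - Num.sqrt (1 - (1 - mu) / 4)) * #|G|%:R].
Proof.
have [J rJ] : exists J, r ^+ J <= (3 * n)^-1.
  by apply: expr_small => //; rewrite invr_gt0 mulr_gt0.
have small x : Mj J.+1 x <= 1.
  apply: (@le_trans _ _ (\sum_x Mj J.+1 x)).
    rewrite (bigD1 x) //= lerDl sumr_ge0 // => y _; exact: (Mj_ge0 J.+1).
  apply: le_trans (sumMj _) _; rewrite -ler_pdivlMr ?mulr_gt0 // mul1r.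
  apply: le_trans rJ; rewrite exprS ler_piMl ?exprn_ge0 //; exact: ltW.
pose g x := \sum_(j < J.+1) Mj j x.
have g1 x : 1 <= g x.
  rewrite /g big_ord_recl (_ : Mj (@ord0 J) x = 1) // lerDl.
  by apply: sumr_ge0 => j _; exact: Mj_ge0.
have Mg x : M g x <= g x.
  have -> : M g x = \sum_(j < J.+1) Mj j.+1 x.
    rewrite /M (lazy_sum (fun j : 'I_J.+1 => Mj j)) mulr_sumr.
    by apply: eq_bigr.
  rewrite big_ord_recr /g big_ord_recl (_ : Mj (@ord0 J) x = 1) // addrC.
  by rewrite lerD // small.
exists g; split => // [x xB|x u xu|].
- have := Mg x; rewrite /M /D xB mulrC ler_pdivrMr // /lazy => h.
  have -> : 1 - (1 - mu) / 4 = 2 * alpha - 1 by rewrite /alpha /eta; field.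
  clra.
- have h : kap * lazy g x <= g x.
    apply: le_trans (Mg x); apply: ler_wpM2r => //.
    by apply: lazy_ge0 => y; exact: le_trans (g1 y).
  have h2 : kap * avg g x <= 2 * g x.
    by move: h; rewrite /lazy; have := g1 x; have := kap_gt0; nra.
  have h3 : g u <= k%:R * avg g x.
    rewrite /avg degG mulrC divfK ?pnatr_eq0 -?lt0n // (bigD1 u) //= lerDl.
    by apply: sumr_ge0 => y _; exact: le_trans (g1 y).
  apply: le_trans h3 _.
  have -> : 32 * k%:R / (1 - mu) * g x = k%:R * (2 * g x / kap).
    by rewrite /kap -/eta; field; rewrite gt_eqF.
  by rewrite ler_wpM2l // ler_pdivlMr // mulrC.
- rewrite /g exchange_big /=.
  apply: (@le_trans _ _ (\sum_(j < J.+1) r ^+ j * (3 * n))).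
    by apply: ler_sum => j _; exact: sumMj.
  rewrite -mulr_suml -/eta -/r.
  have := @sum_geometric_le R r J.+1 r_ge0 r_lt1.
  have -> : 3 / (1 - r) * #|G|%:R = (1 - r)^-1 * (3 * n) by rewrite /n; ring.
  by move=> h; rewrite ler_wpM2r // mulr_ge0 // ltW.
Qed.

(** Taking logarithms turns the multiplicative decrease into an additive drift,
    and tames the growth: concavity of ln bounds the sum of ln g over a set Y
    by #|Y| times the logarithm of #|G| / #|Y|, up to a multiple of #|Y| (take
    t = #|G| / #|Y|), whereas g itself can be as large as a power of #|G| at a
    single vertex. *)
Lemma log_lyapunov : exists L : G -> R,
  [/\ forall x, 0 <= L x,
      forall x, x \in B -> avg L x <= L x - (1 - mu) / 4,
      forall x u, adj x u -> L u <= L x + ln (32 * k%:R / (1 - mu))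
    & forall (Y : {set G}) (t : R), 0 < t ->
        \sum_(y in Y) L y <= #|Y|%:R * ln t
          + 3 / (1 - Num.sqrt (1 - (1 - mu) / 4)) * #|G|%:R / t].
Proof.
have [g [g1 gB gadj gsum]] := lyapunov_function.
have g0 x : 0 < g x by exact: lt_le_trans (g1 x).
exists (fun x => ln (g x)); split => [x|x xB|x u xu|Y t t0].
- exact: ln_ge0.
- have a0 : 0 < avg g x.
    rewrite divr_gt0 ?degG ?ltr0n //.
    have /card_gt0P[u xu] : (0 < degree x)%N by rewrite degG.
    rewrite (bigD1 u) //= ltr_wpDr // sumr_ge0 // => y _; exact: ltW.
  apply: (@le_trans _ _ (avg (fun u => ln (avg g x) - 1 + (avg g x)^-1 * g u) x)).
    apply: le_avg => u _; apply: le_trans (ln_le_tangent (g0 u) a0) _.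
    by rewrite mulrC; clra.
  rewrite avgD avgZ (avg_const degG k_gt0) mulVf ?gt_eqF // subrK.
  have q0 : 0 < 1 - (1 - mu) / 4 by rewrite -/eta; clra.
  apply: (@le_trans _ _ (ln ((1 - (1 - mu) / 4) * g x))).
    by rewrite ler_ln ?posrE ?(mulr_gt0 q0) // gB.
  rewrite lnM ?posrE // addrC lerD2l.
  by apply: le_ln1Dx; rewrite -/eta; clra.
- have k0 : 0 < 32 * k%:R / (1 - mu) by rewrite divr_gt0 ?mulr_gt0 // ltr0n.
  rewrite addrC -lnM ?posrE // ler_ln ?posrE ?(mulr_gt0 k0) // gadj //.
- apply: (@le_trans _ _ (\sum_(y in Y) (ln t + g y / t))).
    by apply: ler_sum => y _; apply: le_trans (ln_le_tangent (g0 y) t0) _; clra.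
  rewrite big_split /= sumr_const mulr_natl lerD2l -mulr_suml.
  rewrite ler_pM2r ?invr_gt0 //; apply: le_trans gsum.
  rewrite [leRHS](bigID (mem Y)) /= lerDl sumr_ge0 // => y _; exact: ltW.
Qed.

End Lyapunov.

(** * The controller's gain *)

Section Boost.
Context {R : realType}.

Lemma powR_le_tangent (t a : R) : 0 <= t -> 0 < a -> a < 1 ->
  t `^ a <= a * t + (1 - a).
Proof.
move=> t0 a0 a1; have a1' : 0 < 1 - a by rewrite subr_gt0.
have pq : a^-1^-1 + (1 - a)^-1^-1 = 1 by rewrite !invrK addrC subrK.
have := @conjugate_powR R (t `^ a) 1 a^-1 (1 - a)^-1 (powR_ge0 _ _) ler01.
rewrite !invr_gt0 => /(_ a0 a1' pq); rewrite !invrK.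
by rewrite mulr1 powR1 mul1r -powRrM divff ?gt_eqF // powRr1 // mulrC.
Qed.

Lemma le_powR (a x y : R) : 0 <= a -> 0 <= x -> x <= y -> x `^ a <= y `^ a.
Proof.
move=> a0 x0 xy; apply: ge0_ler_powR => //; rewrite nnegrE //.
exact: le_trans xy.
Qed.

(** One step of the biased walk towards the neighbour with the largest z makes
    the expectation of z^a at least the a-th power of the unbiased expectation:
    z^a >= z * M^(a-1) when z <= M, and the rest is the weighted AM-GM
    inequality. *)
Lemma boost (G : graph) (z : G -> R) (a : R) (x u : G) : 0 < a -> a < 1 ->
  (forall y, 0 < z y) -> adj x u -> (forall y, adj x y -> z y <= z u) ->
  avg z x `^ a <= a * avg (fun y => z y `^ a) x + (1 - a) * z u `^ a.
Proof.
move=> a0 a1 z0 xu zu; set M := z u; have M0 : 0 < M := z0 u.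
have A0 : 0 <= avg z x by apply: avg_ge0 => y; exact: ltW.
have h1 : M `^ a / M * avg z x <= avg (fun y => z y `^ a) x.
  rewrite -avgZ; apply: le_avg => y /zu yM.
  have y0 : 0 < z y / M by rewrite divr_gt0.
  have yM1 : z y / M <= 1 by rewrite ler_pdivrMr // mul1r.
  have : z y / M <= (z y / M) `^ a.
    by apply: ger1_powR; rewrite ?y0 // ltW.
  move=> /(ler_wpM2l (powR_ge0 M a)).
  rewrite -powRM; [|exact: ltW|exact: ltW].
  rewrite [M * (_ / _)]mulrC divfK ?gt_eqF // => h.
  by apply: le_trans h; rewrite -mulrA [M^-1 * _]mulrC.
have t0 : 0 <= avg z x / M by rewrite divr_ge0 // ltW.
have h2 := powR_le_tangent t0 a0 a1.
have {}h2 := ler_wpM2l (powR_ge0 M a) h2.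
have E : M `^ a * (avg z x / M) `^ a = avg z x `^ a.
  rewrite -powRM //; last exact: ltW.
  by rewrite [M * (_ / _)]mulrC divfK ?gt_eqF.
rewrite E in h2; apply: le_trans h2 _.
have := ler_wpM2l (ltW a0) h1.
have -> : M `^ a * (a * (avg z x / M) + (1 - a))
  = a * (M `^ a / M * avg z x) + (1 - a) * M `^ a.
  by field; rewrite gt_eqF.
by rewrite lerD2r.
Qed.

End Boost.

(** * Reaching a set from almost everywhere *)

Section Green.
Context {R : realType} {G : graph} {k : nat} {mu : R}.
Hypotheses (degG : forall x : G, degree x = k) (k_gt0 : (0 < k)%N).
Hypotheses (mu_gt0 : 0 < mu) (gapG : contracts G mu).
Implicit Types (f : G -> R) (x u : G) (U : {set G}).

Definition indic U x : R := (x \in U)%:R.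

Lemma iter_lazy_ge0 f t x : (forall u, 0 <= f u) -> 0 <= iter t lazy f x.
Proof. by move=> f0; elim: t x => [|t IH] x //=; exact: lazy_ge0. Qed.

Lemma iter_lazy_indic_le1 U t x : iter t lazy (indic U) x <= 1.
Proof.
elim: t x => [|t IH] x /=; first by rewrite /indic lern1 leq_b1.
by rewrite -[leRHS](lazy_const degG k_gt0 1 x); exact: le_lazy.
Qed.

Lemma sum_indic U : \sum_x indic U x = #|U|%:R.
Proof.
rewrite -sum1_card natr_sum [RHS]big_mkcond; apply: eq_bigr => x _.
by rewrite /indic; case: (x \in U).
Qed.

Lemma contract_iter f t : \sum_x f x = 0 ->
  \sum_x iter t lazy f x = 0 /\
  \sum_x iter t lazy f x ^+ 2 <= mu ^+ t * \sum_x f x ^+ 2.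
Proof.
move=> f0; elim: t => [|t [s0 IH]] /=; first by rewrite mul1r.
split; first by rewrite (sum_lazy degG k_gt0).
apply: le_trans (gapG s0) _.
by rewrite exprS -mulrA ler_wpM2l // ltW.
Qed.

(** Chebyshev's inequality for the law of the lazy walk after t steps. *)
Lemma few_far U t (c : R) : c = #|U|%:R / #|G|%:R ->
  #|[set x | iter t lazy (indic U) x < c / 2]|%:R * c <= 4 * mu ^+ t * #|G|%:R.
Proof.
move=> cE.
have n0 : 0 < #|G|%:R :> R by rewrite ltr0n; exact: graph_inhabited.
have c0 : 0 <= c by rewrite cE divr_ge0.
have cn : c * #|G|%:R = #|U|%:R by rewrite cE divfK // gt_eqF.
have [U0|U0] := posnP #|U|.
  by rewrite cE U0 !mul0r mulr0 !mulr_ge0 ?exprn_ge0 // ltW.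
have c_gt0 : 0 < c by rewrite cE divr_gt0 // ltr0n.
pose h x := indic U x - c.
have h0 : \sum_x h x = 0.
  by rewrite sumrB sum_indic sumr_const -[c *+ _]mulr_natr cn subrr.
have itE s x : iter s lazy (indic U) x = iter s lazy h x + c.
  elim: s x => [|s IH] x /=; first by rewrite /h subrK.
  by rewrite (eq_lazy IH) lazyD (lazy_const degG k_gt0).
have [_ bnd] := contract_iter t h0.
have hU : \sum_x h x ^+ 2 <= #|U|%:R.
  have -> : \sum_x h x ^+ 2
     = \sum_x indic U x - 2 * c * \sum_x indic U x + c ^+ 2 * #|G|%:R.
    have -> : c ^+ 2 * #|G|%:R = \sum_(x : G) c ^+ 2.
      by rewrite sumr_const -[_ *+ _ in RHS]mulr_natr.
    rewrite mulr_sumr -sumrB -big_split; apply: eq_bigr => x _ /=.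
    by rewrite /h /indic; case: (x \in U) => /=; ring.
  rewrite sum_indic (_ : c ^+ 2 * #|G|%:R = c * #|U|%:R); last first.
    by rewrite -cn; ring.
  have : 0 <= c * #|U|%:R by rewrite mulr_ge0.
  lra.
set Far := [set x | _].
have low : #|Far|%:R * (c ^+ 2 / 4) <= \sum_x iter t lazy h x ^+ 2.
  rewrite (bigID (mem Far)) /= -[leLHS]addr0 lerD //; last first.
    by apply: sumr_ge0 => x _; exact: sqr_ge0.
  rewrite mulr_natl -sumr_const; apply: ler_sum => x.
  rewrite inE itE => hx.
  have hx' : iter t lazy h x < - (c / 2) by lra.
  have -> : c ^+ 2 / 4 = (c / 2) ^+ 2 by field.
  by rewrite -[leRHS]sqrrN ler_pXn2r ?nnegrE //; lra.
have := le_trans low bnd.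
have mt : 0 <= mu ^+ t by rewrite exprn_ge0 // ltW.
move=> /le_trans /(_ (ler_wpM2l mt hU)).
rewrite -cn => hh.
rewrite -(ler_pM2r c_gt0); lra.
Qed.

Variables (U : {set G}) (beta : R) (l : nat).
Hypotheses (beta_gt0 : 0 < beta) (beta_lt1 : beta < 1).

(** The truncated Green function of the lazy walk killed at rate 1 - beta,
    started from U. *)
Definition green x : R := \sum_(t < l.+1) beta ^+ t * iter t lazy (indic U) x.

Let term_ge0 t x : 0 <= beta ^+ t * iter t lazy (indic U) x.
Proof.
by rewrite mulr_ge0 ?exprn_ge0 ?(ltW beta_gt0) // iter_lazy_ge0 // => u;
  rewrite ler0n.
Qed.

Lemma green_le x : green x <= (1 - beta)^-1.
Proof.
apply: le_trans (sum_geometric_le l.+1 (ltW beta_gt0) beta_lt1).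
apply: ler_sum => t _; rewrite ler_piMr ?exprn_ge0 ?(ltW beta_gt0) //.
exact: iter_lazy_indic_le1.
Qed.

Lemma green_ge_last x : beta ^+ l * iter l lazy (indic U) x <= green x.
Proof. by rewrite /green big_ord_recr /= lerDr sumr_ge0. Qed.

(** Laziness doubles the growth: lazy averaging multiplies green by at least
    1 / beta off U, hence plain averaging by at least 2 / beta - 1 > 1. *)
Lemma avg_green x : x \notin U -> (2 / beta - 1) * green x <= avg green x.
Proof.
move=> xU.
have step : green x <= beta * lazy green x.
  rewrite (lazy_sum (fun (t : 'I_l.+1) u => beta ^+ t * iter t lazy (indic U) u)).
  rewrite mulr_sumr big_ord_recr /green big_ord_recl.
  have -> : beta ^+ (@ord0 l) * iter (@ord0 l) lazy (indic U) x = 0.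
    by rewrite /indic /= (negbTE xU) mulr0.
  rewrite add0r -[leLHS]addr0; apply: lerD.
    apply: ler_sum => t _; rewrite lazyZ mulrA -exprS.
    by rewrite lexx.
  rewrite lazyZ mulrA -exprS; exact: (term_ge0 l.+1).
move: step; rewrite /lazy => step.
have : green x / beta <= (green x + avg green x) / 2.
  by rewrite ler_pdivrMr // mulrC.
have -> : (2 / beta - 1) * green x = 2 * (green x / beta) - green x.
  by field; rewrite gt_eqF.
lra.
Qed.

End Green.

(** * Potentials for hitting a set *)

(** H decreases by at least one per step of the biased walk at x, for a suitable
    neighbour u offered by the controller: H then bounds expected hitting times. *)
Definition drift (R : realType) (G : graph) (eps : R) (H : G -> R) (x : G) :=
  exists2 u, adj x u & 1 + (1 - eps) * avg H x + eps * H u <= H x.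

Section Drift.
Context {R : realType} {G : graph} {k : nat}.
Hypotheses (degG : forall x : G, degree x = k) (k_gt0 : (0 < k)%N).
Implicit Types (f H : G -> R) (x u : G).

Lemma avg_le_max f x : exists2 u, adj x u & avg f x <= f u /\
  forall y, adj x y -> f y <= f u.
Proof.
have /card_gt0P[u0 xu0] : (0 < degree x)%N by rewrite degG.
have [u xu umax] : exists2 u, adj x u & forall y, adj x y -> f y <= f u.
  exists [arg max_(u > u0 in [pred u | adj x u]) f u]%O.
    by case: arg_maxP.
  by case: arg_maxP => // i _ h y xy; exact: h.
exists u => //; split => //.
by rewrite -(avg_const degG k_gt0 (f u) x); exact: le_avg.
Qed.

Lemma avg_ge_min f x : exists2 u, adj x u & f u <= avg f x.
Proof.
have [u xu [h _]] := avg_le_max (fun y => - f y) x.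
by exists u => //; move: h; rewrite avgN lerN2.
Qed.

Variables (a eps A B V del c1 theta kappa : R) (w L : G -> R) (U : {set G}).
Hypotheses (a_gt0 : 0 < a) (a_lt1 : a < 1) (eps_ge : 1 - a <= eps).
Hypotheses (eps_le1 : eps <= 1) (A_ge0 : 0 <= A) (B_ge0 : 0 <= B).
Hypotheses (th_gt0 : 0 < theta) (kappa_ge1 : 1 <= kappa).
Hypothesis w_grows : forall x, x \notin U -> kappa * w x <= avg w x.
Hypothesis w_le : forall x, Num.max (w x) theta `^ a <= V.
Hypothesis L_ge0 : forall x, 0 <= L x.
Hypothesis L_down : forall x, w x < theta -> avg L x <= L x - del.
Hypothesis L_step : forall x u, adj x u -> L u <= L x + c1.
Hypothesis B_del : 1 <= B * del.
Hypothesis A_large : 1 + B * c1 <= A * ((kappa `^ a - 1) * theta `^ a).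

Let z x : R := Num.max (w x) theta.
Let v x : R := z x `^ a.
Let F x : R := A * (V - v x) + B * L x.

(** The first term of F drives the walk to U from the vertices where w is at least
    theta, the second one takes it away from the others. Truncating w at theta
    makes the first term maximal, hence harmless, at those others. *)
Definition hit_potential x : R := if x \in U then 0 else F x.

Let F_ge0 x : 0 <= F x.
Proof. by rewrite addr_ge0 ?mulr_ge0 // subr_ge0 w_le. Qed.

Lemma hit_potential_ge0 x : 0 <= hit_potential x.
Proof. by rewrite /hit_potential; case: ifP. Qed.

Lemma hit_potential_le x : hit_potential x <= A * V + B * L x.
Proof.
rewrite /hit_potential; case: ifP => _.
  rewrite addr_ge0 ?mulr_ge0 //; exact: le_trans (powR_ge0 _ _) (w_le x).
by rewrite /F lerD2r ler_wpM2l // gerBl powR_ge0.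
Qed.

Let avgF x : avg F x = A * (V - avg v x) + B * avg L x.
Proof.
rewrite /F avgD !avgZ; congr (A * _ + _).
by rewrite avgD avgN (avg_const degG k_gt0).
Qed.

Let z_gt0 x : 0 < z x. Proof. by rewrite lt_max th_gt0 orbT. Qed.

(** Where w < theta an unbiased step decreases L, and the controller need only do
    no worse than average. Elsewhere he maximizes w; the gain, at least
    proportional to theta^a, is made to dominate the possible increase of L by the
    choice of A. *)
Lemma hit_potential_drift x : x \notin U -> drift eps hit_potential x.
Proof.
move=> xU.
have le_F y : hit_potential y <= F y.
  by rewrite /hit_potential; case: ifP.
have kappa_ge0 : 0 <= kappa := le_trans ler01 kappa_ge1.
have eps0 : 0 <= eps by move: a_lt1 eps_ge; lra.
have eps1 : 0 <= 1 - eps by rewrite subr_ge0.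
suff [u xu h] : exists2 u, adj x u & 1 + (1 - eps) * avg F x + eps * F u <= F x.
  exists u => //; rewrite {3}/hit_potential (negbTE xU); apply: le_trans h.
  apply: lerD; last exact: ler_wpM2l.
  by rewrite lerD2l ler_wpM2l // le_avg.
have [bad|good] := ltP (w x) theta.
  have [u xu uF] := avg_ge_min F x; exists u => //.
  have h1 : 1 + avg F x <= F x.
    have vx y : v x <= v y.
      have zx : z x = theta by rewrite /z max_r // ltW.
      rewrite /v le_powR ?(ltW a_gt0) ?(ltW (z_gt0 x)) //.
      by rewrite zx le_max lexx orbT.
    have h2 : v x <= avg v x.
      by rewrite -[leLHS](avg_const degG k_gt0 _ x); exact: le_avg.
    rewrite avgF /F.
    have := ler_wpM2l A_ge0 h2; have := ler_wpM2l B_ge0 (L_down bad).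
    move: B_del; lra.
  have := ler_wpM2l eps0 uF; lra.
have [u xu [uavg umax]] := avg_le_max z x; exists u => //.
have vmax : avg v x <= v u.
  rewrite -(avg_const degG k_gt0 (v u) x); apply: le_avg => y xy.
  by rewrite /v le_powR ?(ltW a_gt0) ?(ltW (z_gt0 y)) // umax.
have h1 : kappa `^ a * v x <= (1 - eps) * avg v x + eps * v u.
  apply: (@le_trans _ _ (avg z x `^ a)).
    rewrite /v -powRM ?(ltW (z_gt0 x)) //.
    rewrite le_powR ?mulr_ge0 ?(ltW a_gt0) ?(ltW (z_gt0 x)) //.
    have -> : z x = w x by rewrite /z max_l.
    apply: le_trans (w_grows xU) _; apply: le_avg => y _.
    by rewrite /z le_max lexx.
  apply: le_trans (boost a_gt0 a_lt1 z_gt0 xu umax) _; rewrite -/v -/(v u).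
  have : 0 <= (eps - (1 - a)) * (v u - avg v x).
    by rewrite mulr_ge0 // subr_ge0.
  lra.
have h2 : (1 - eps) * avg L x + eps * L u <= L x + c1.
  have hu := ler_wpM2l eps0 (L_step xu).
  have ha : avg L x <= L x + c1.
    by rewrite -[leRHS](avg_const degG k_gt0 _ x); apply: le_avg => y /L_step.
  have := ler_wpM2l eps1 ha; lra.
have h3 : theta `^ a <= v x.
  rewrite /v le_powR ?(ltW a_gt0) ?(ltW th_gt0) //.
  by rewrite /z le_max lexx orbT.
have h4 : 0 <= kappa `^ a - 1.
  by rewrite subr_ge0 -(powRr0 kappa); apply: ler_powR => //; exact: ltW.
have h5 := ler_wpM2l A_ge0 (ler_wpM2l h4 h3).
rewrite avgF /F.
have := ler_wpM2l A_ge0 h1; have := ler_wpM2l B_ge0 h2.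
move: A_large; lra.
Qed.

End Drift.

(** * Expected hitting times on expanders *)

Lemma le_of_eq (R : realType) (x y : R) : x = y -> x <= y.
Proof. by move=> ->. Qed.

Lemma bernoulli (R : realType) (y : R) (N : nat) : 0 <= y -> y <= 1 ->
  1 - N%:R * y <= (1 - y) ^+ N.
Proof.
move=> y0 y1; elim: N => [|N IH]; first by rewrite mul0r subr0.
have y2 : 0 <= 1 - y by rewrite subr_ge0.
have := ler_wpM2l y2 IH; rewrite -exprS -natr1.
have : 0 <= N%:R * (y * y) by rewrite !mulr_ge0.
move=> h1 h2; apply: le_trans h2; lra.
Qed.

Section HittingBound.
Context {R : realType} (mu eps : R) (D : nat).
Hypotheses (mu_gt0 : 0 < mu) (mu_lt1 : mu < 1).
Hypotheses (eps_gt0 : 0 < eps) (eps_le1 : eps <= 1).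

Let eta : R := 1 - mu.
Let a : R := 1 - eps / 2.
(* N is so large that the exponent b below stays under 1. *)
Let N : nat := (Num.truncn (2 / eps)).+1.
Let beta : R := 1 - eta / N%:R.
Definition hit_exponent : R := a * (1 + N%:R^-1).
Local Notation b := hit_exponent.
Let kappa : R := 2 / beta - 1.
Let c1 : R := ln (32 * D%:R / eta).
Let V : R := (1 - beta)^-1 `^ a.
Let S : R := 3 / (1 - Num.sqrt (1 - eta / 4)).
Let C0 : R := (2 / beta) `^ a * (64 / eta) `^ (a / N%:R).
Let Amp : R := (1 + 4 / eta * c1) / (kappa `^ a - 1) * C0.
Definition hit_constant : R := Amp * V + 4 / eta * (b^-1 + S).
Local Notation K := hit_constant.

Let eta_gt0 : 0 < eta. Proof. by rewrite subr_gt0. Qed.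
Let eta_lt1 : eta < 1. Proof. by rewrite gtrBl. Qed.
Let N_gt0 : 0 < N%:R :> R. Proof. by rewrite ltr0n. Qed.
Let N_ge1 : 1 <= N%:R :> R. Proof. by rewrite ler1n. Qed.
Let a_gt0 : 0 < a. Proof. by move: eps_le1; rewrite /a; lra. Qed.
Let a_lt1 : a < 1. Proof. by move: eps_gt0; rewrite /a; lra. Qed.

Let N_large : N%:R^-1 <= eps / 2.
Proof.
rewrite -[eps / 2]invf_div lef_pV2 ?posrE ?divr_gt0 //.
by rewrite ltW // truncnS_gt.
Qed.

Lemma hit_exponent_gt0 : 0 < b.
Proof. by rewrite mulr_gt0 // addr_gt0 // invr_gt0. Qed.

Lemma hit_exponent_lt1 : b < 1.
Proof.
have h : b <= a * (1 + eps / 2) by rewrite ler_pM2l // lerD2l.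
apply: le_lt_trans h _; have -> : a * (1 + eps / 2) = 1 - (eps / 2) ^+ 2.
  by rewrite /a; ring.
by rewrite gtrBl exprn_gt0 // divr_gt0.
Qed.

Let eN : 0 < eta / N%:R. Proof. by rewrite divr_gt0. Qed.

Let eN1 : eta / N%:R < 1.
Proof. by rewrite ltr_pdivrMr // mul1r (lt_le_trans eta_lt1). Qed.

Let beta_gt0 : 0 < beta. Proof. by rewrite subr_gt0. Qed.
Let beta_lt1 : beta < 1. Proof. by rewrite gtrBl. Qed.

Let betaN : mu <= beta ^+ N.
Proof.
apply: le_trans (bernoulli N (ltW eN) (ltW eN1)).
by rewrite mulrCA divff ?gt_eqF // mulr1 /eta opprB addrC subrK.
Qed.

Let kappa_gt1 : 1 < kappa.
Proof.
have : 2 < 2 / beta by rewrite ltr_pdivlMr // gtr_pMr.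
rewrite /kappa; lra.
Qed.

Let kappa_a : 1 < kappa `^ a.
Proof.
have kappa_ge0 := ltW (lt_trans ltr01 kappa_gt1).
have := gt0_ltr_powR a_gt0 (_ : 1 \in Num.nneg) (_ : kappa \in Num.nneg).
by rewrite !nnegrE powR1; apply.
Qed.

Let V_gt0 : 0 < V. Proof. by rewrite powR_gt0 // invr_gt0 subr_gt0. Qed.

Let S_gt0 : 0 < S.
Proof.
rewrite divr_gt0 // subr_gt0 -(@expr_lt1 _ 2) ?sqrtr_ge0 // sqr_sqrtr.
  by move: eta_gt0; lra.
by move: eta_lt1; lra.
Qed.

Variables (G : graph) (k : nat).
Hypotheses (degG : forall x : G, degree x = k) (k_gt0 : (0 < k)%N).
Hypotheses (k_le : (k <= D)%N) (gapG : contracts G mu).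
Variable U : {set G}.
Hypothesis U_gt0 : (0 < #|U|)%N.

Let m : R := #|U|%:R.
Let n : R := #|G|%:R.
Variable rho : R.
Hypothesis rhoE : rho = n / m.

Let m_gt0 : 0 < m. Proof. by rewrite ltr0n. Qed.
Let n_gt0 : 0 < n. Proof. by rewrite ltr0n; exact: graph_inhabited. Qed.
Let rho_ge1 : 1 <= rho.
Proof. by rewrite rhoE ler_pdivlMr // mul1r ler_nat max_card. Qed.
Let rho_gt0 : 0 < rho. Proof. exact: lt_le_trans ltr01 rho_ge1. Qed.

Let c1_ge0 : 0 <= c1.
Proof.
apply: ln_ge0; rewrite ler_pdivlMr // mul1r.
have : 1 <= D%:R :> R by rewrite ler1n (leq_trans k_gt0).
by move: eta_lt1; lra.
Qed.

(** After l lazy steps, almost all starting points see U with at least half its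
    density. Here l is logarithmic in rho, and beta is so close to 1 that
    discounting by beta over that time only costs a small power of rho. *)
Let mixing_time : exists l : nat,
  mu ^+ l <= eta / (64 * rho) /\
  beta / (2 * rho) * (eta / (64 * rho)) `^ N%:R^-1 <= beta ^+ l / (2 * rho).
Proof.
set t := eta / (64 * rho).
have t_gt0 : 0 < t by rewrite /t divr_gt0 // mulr_gt0.
have ex : exists l, mu ^+ l <= t by apply: expr_small => //; exact: ltW.
pose l := ex_minn ex.
have [le_t lmin] : mu ^+ l <= t /\ forall j, mu ^+ j <= t -> (l <= j)%N.
  by rewrite /l; case: ex_minnP.
have t_lt1 : t < 1.
  have rho64 : 0 < 64 * rho by rewrite mulr_gt0.
  rewrite /t ltr_pdivrMr // mul1r.
  by move: eta_lt1 rho_ge1; lra.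
clearbody l; exists l; split => //.
case: l le_t lmin => [|l] le_t lmin; first by move: le_t; rewrite expr0 leNgt t_lt1.
have gt_t : t <= (beta ^+ l) `^ N%:R.
  rewrite powR_mulrn ?exprn_ge0 ?(ltW beta_gt0) // -exprM mulnC exprM.
  apply: (@le_trans _ _ (mu ^+ l)).
    by rewrite leNgt; apply/negP => /ltW /lmin; rewrite ltnn.
  by rewrite lerXn2r ?nnegrE ?exprn_ge0 ?(ltW beta_gt0) ?(ltW mu_gt0).
have : t `^ N%:R^-1 <= beta ^+ l.
  have N0 : 0 <= N%:R^-1 :> R by rewrite invr_ge0.
  have := le_powR N0 (ltW t_gt0) gt_t.
  rewrite -powRrM divff ?gt_eqF // powRr1 ?exprn_ge0 //; exact: ltW.
have b2 : 0 <= beta / (2 * rho) by rewrite ltW // divr_gt0 // mulr_gt0.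
move=> /(ler_wpM2l b2) h; apply: le_trans h _.
by rewrite exprS mulrAC.
Qed.

(** For Y of the size of U, the last bound is #|Y| times an average hitting time
    of order rho^b, however badly Y is placed with respect to U. *)
Lemma hitting_potential : exists H : G -> R,
  [/\ forall x, 0 <= H x,
      forall x, x \in U -> H x = 0,
      forall x, x \notin U -> drift eps H x
    & forall Y : {set G}, (#|Y| <= #|U|)%N ->
        \sum_(y in Y) H y <= K * (m * rho `^ b)].
Proof.
have b_gt0 := hit_exponent_gt0.
have [l [mul thl]] := mixing_time.
pose theta := beta ^+ l / (2 * rho).
have th_gt0 : 0 < theta by rewrite /theta divr_gt0 ?exprn_gt0 ?mulr_gt0 //.
pose w := @green R G U beta l.
pose Bad := [set x | w x < theta].
have Bad_small : #|Bad|%:R <= (1 - mu) / 16 * #|G|%:R.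
  have cE : rho^-1 = #|U|%:R / #|G|%:R by rewrite rhoE invf_div.
  have far := @few_far R G k mu degG k_gt0 mu_gt0 gapG U l rho^-1 cE.
  set Far := [set x | _] in far.
  have sub : (#|Bad| <= #|Far|)%N.
    apply/subset_leq_card/fintype.subsetP => x; rewrite !inE => wx.
    have bl : 0 < beta ^+ l by rewrite exprn_gt0.
    rewrite -(ltr_pM2l bl); apply: le_lt_trans (green_ge_last U l beta_gt0 x) _.
    apply: lt_le_trans wx _; rewrite /theta; apply: le_of_eq.
    by field; rewrite gt_eqF.
  have {}far : #|Far|%:R <= 4 * (mu ^+ l * rho) * n.
    move: far; rewrite ler_pdivrMr // => far; apply: le_trans far _.
    by apply: le_of_eq; rewrite /n; ring.
  apply: (@le_trans _ _ #|Far|%:R); first by rewrite ler_nat.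
  apply: le_trans far _; rewrite ler_pM2r // -/eta.
  have := ler_wpM2r (ltW rho_gt0) mul.
  have -> : eta / (64 * rho) * rho = eta / 64 by field; rewrite gt_eqF.
  by lra.
have [L [L0 Ldown Lstep Lsum]] :=
  log_lyapunov degG k_gt0 mu_gt0 mu_lt1 gapG Bad_small.
rewrite -/eta -/S in Ldown Lstep Lsum.
have th_le1 : theta <= (1 - beta)^-1.
  apply: (@le_trans _ _ 1); last by rewrite invf_ge1 ?subr_gt0 // gerBl ltW.
  have rho2 : 0 < 2 * rho by rewrite mulr_gt0.
  rewrite /theta ler_pdivrMr // mul1r.
  have : beta ^+ l <= 1 by rewrite exprn_ile1 ?ltW //.
  by move: rho_ge1; lra.
have wV x : Num.max (w x) theta `^ a <= V.
  apply: le_powR; [exact: ltW | by rewrite le_max (ltW th_gt0) orbT |].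
  by rewrite ge_max th_le1 (green_le degG k_gt0).
have etaV : 0 < 4 / eta by rewrite divr_gt0.
have num0 : 0 < 1 + 4 / eta * c1 by rewrite ltr_pwDl // mulr_ge0 // ltW.
have den0 : 0 < kappa `^ a - 1 by rewrite subr_gt0.
have tha : 0 < theta `^ a by rewrite powR_gt0.
pose A := (1 + 4 / eta * c1) / ((kappa `^ a - 1) * theta `^ a).
have A0 : 0 < A by rewrite /A divr_gt0 ?mulr_gt0 //.
have AV : A <= Amp * rho `^ b.
  have thV : (theta `^ a)^-1 <= C0 * rho `^ b.
    pose th' := beta / (2 * rho) * (eta / (64 * rho)) `^ N%:R^-1.
    have th'0 : 0 < th' by rewrite /th' mulr_gt0 ?powR_gt0 ?divr_gt0 ?mulr_gt0 //.
    have h : th' `^ a <= theta `^ a by apply: le_powR => //; exact: ltW.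
    apply: (@le_trans _ _ (th' `^ a)^-1).
      by rewrite lef_pV2 ?posrE ?powR_gt0.
    apply: le_of_eq; rewrite /th' powRM ?powR_ge0 ?divr_ge0 ?mulr_ge0 ?ltW //.
    rewrite invfM /C0 -powRrM [_^-1 * a]mulrC -!powRN.
    have Einv (x y r : R) : 0 < x -> 0 < y ->
        (x / (y * rho)) `^ (- r) = (y / x) `^ r * rho `^ r.
      move=> x0 y0; rewrite -powRM ?divr_ge0 ?ltW //.
      rewrite -mulN1r powRrM powR_inv1 ?divr_ge0 ?mulr_ge0 ?ltW //.
      by congr (_ `^ _); field; rewrite !gt_eqF.
    rewrite !Einv // mulrACA; congr (_ * _).
    by rewrite -powRD ?(gt_eqF rho_gt0) ?implybT // /hit_exponent mulrDr mulr1.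
  rewrite /A /Amp invfM [leLHS]mulrA -[leRHS]mulrA ler_pM2l //.
  by rewrite divr_gt0.
pose H := hit_potential a A (4 / eta) V theta w L U.
have HF : forall x, x \notin U -> drift eps H x.
  move=> x xU.
  apply: (@hit_potential_drift R G k degG k_gt0 a eps A (4 / eta) V (eta / 4) c1
     theta kappa) => //.
  - by rewrite /a; move: eps_gt0; lra.
  - exact: ltW.
  - exact: ltW.
  - exact: ltW.
  - move=> y yU; exact: avg_green.
  - by move=> y wy; apply: Ldown; rewrite inE.
  - move=> y u yu; apply: le_trans (Lstep y u yu) _.
    rewrite lerD2l ler_ln ?posrE ?divr_gt0 ?mulr_gt0 ?ltr0n //.
      by rewrite ler_pM2r ?invr_gt0 // ler_pM2l // ler_nat.
    exact: leq_trans k_gt0 k_le.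
  - by rewrite mulrA divfK ?divff // gt_eqF.
  - by rewrite /A divfK // gt_eqF // mulr_gt0.
exists H; split => //.
- move=> x; apply: hit_potential_ge0 => //; exact: ltW.
- by move=> x xU; rewrite /H /hit_potential xU.
- move=> Y YU.
  apply: (@le_trans _ _ (\sum_(y in Y) (A * V + 4 / eta * L y))).
    apply: ler_sum => y _; apply: hit_potential_le => //; exact: ltW.
  rewrite big_split /= sumr_const -[_ *+ _]mulr_natl -mulr_sumr.
  have Ym : #|Y|%:R <= m by rewrite ler_nat.
  have lnr : ln rho <= rho `^ b / b.
    rewrite ler_pdivlMr // mulrC -ln_powR ltW // ln_sublinear //.
    exact: powR_gt0.
  have rb : 1 <= rho `^ b.
    by rewrite -(powRr0 rho); apply: ler_powR => //; exact: ltW.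
  have sumL : \sum_(y in Y) L y <= m * (rho `^ b / b) + S * (m * rho `^ b).
    apply: le_trans (Lsum Y rho rho_gt0) _; apply: lerD.
      by apply: ler_pM => //; exact: ln_ge0.
    have -> : S * #|G|%:R / rho = S * m.
      by rewrite rhoE -/n; field; rewrite !gt_eqF.
    by rewrite ler_pM2l // ler_peMr // ltW.
  have h1 : #|Y|%:R * (A * V) <= m * (Amp * rho `^ b * V).
    apply: ler_pM => //; first by rewrite mulr_ge0 ?ltW //.
    by rewrite ler_pM2r.
  apply: le_trans (lerD h1 (ler_wpM2l (ltW etaV) sumL)) _.
  apply: le_of_eq; rewrite /hit_constant; field.
  by rewrite !gt_eqF.
Qed.

End HittingBound.

(** * From hitting times to the cover time *)

(** The constant exists because uphalf N <= 3 N / 4 for N > 1 and the exponent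
    1 - b is positive: K0 = K c / (1 - c) with c = (3/4)^(1-b). *)
Lemma cost_recursion (R : realType) (b K : R) : 0 < b -> b < 1 -> 0 <= K ->
  exists2 K0 : R, 0 <= K0 & forall N : nat, (1 < N)%N ->
    K * (uphalf N)%:R `^ (1 - b) + K0 * (uphalf N)%:R `^ (1 - b)
      <= K0 * N%:R `^ (1 - b).
Proof.
move=> b0 b1 K_ge0; have b1' : 0 < 1 - b by rewrite subr_gt0.
pose c : R := (3 / 4) `^ (1 - b).
have c0 : 0 <= c by exact: powR_ge0.
have c1 : 0 < 1 - c.
  have h34 : 3 / 4 < 1 :> R by lra.
  have := gt0_ltr_powR b1' (_ : 3 / 4 \in Num.nneg) (_ : 1 \in Num.nneg) h34.
  by rewrite powR1 subr_gt0; apply; rewrite nnegrE ?divr_ge0.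
exists (K * c / (1 - c)); first by rewrite divr_ge0 ?mulr_ge0 // ltW.
move=> N N2; rewrite -mulrDl.
have h : (uphalf N)%:R `^ (1 - b) <= c * N%:R `^ (1 - b) :> R.
  rewrite -powRM ?divr_ge0 //.
  apply: le_powR => //; first exact: ltW.
  have : (uphalf N * 4 <= 3 * N)%N.
    have := odd_double_half N; have := uphalfE N.
    case: N N2 => [|[|N]] // _.
    by rewrite uphalf_half -addnn; case: (odd _); lia.
  by rewrite -(ler_nat R) !natrM; lra.
apply: le_trans (ler_wpM2l _ h) _.
  by rewrite addr_ge0 ?divr_ge0 ?mulr_ge0 // ltW.
apply: le_of_eq; field; by rewrite gt_eqF.
Qed.

Section Cost.
Context {R : realType} {G : graph} (b K K0 : R).
Hypotheses (b_gt0 : 0 < b) (b_lt1 : b < 1) (K0_ge0 : 0 <= K0).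
Hypothesis K0_rec : forall N : nat, (1 < N)%N ->
    K * (uphalf N)%:R `^ (1 - b) + K0 * (uphalf N)%:R `^ (1 - b)
      <= K0 * N%:R `^ (1 - b).
Implicit Types (U W : {set G}) (x y u : G) (s : seq G).

Variable H : {set G} -> G -> R.
Hypothesis H_ge0 : forall W x, (0 < #|W|)%N -> 0 <= H W x.
Hypothesis H_in : forall W x, x \in W -> H W x = 0.
Hypothesis H_sum : forall W (Y : {set G}), (0 < #|W|)%N -> (#|Y| <= #|W|)%N ->
  \sum_(y in Y) H W y <= K * (#|W|%:R * (#|G|%:R / #|W|%:R) `^ b).

Let target U x : {set G} :=
  [arg min_(W < U | (W \subset U) && (0 < #|W|)%N) H W x]%O.

(** A walk that must hit U may aim at any part of U; taking the best part makes
    the bound monotone in U. *)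
Definition hit U x : R := if (0 < #|U|)%N then H (target U x) x else 0.

Let targetP U x : (0 < #|U|)%N ->
  [/\ target U x \subset U, (0 < #|target U x|)%N
    & forall W, W \subset U -> (0 < #|W|)%N -> H (target U x) x <= H W x].
Proof.
move=> U0; rewrite /target; case: arg_minP => [|W /andP[WU W0] Wmin].
  by rewrite U0 subxx.
by split => // W' W'U W'0; apply: Wmin; rewrite W'U.
Qed.

Lemma hit_ge0 U x : 0 <= hit U x.
Proof.
rewrite /hit; case: ifP => // U0; have [_ t0 _] := targetP x U0.
exact: H_ge0.
Qed.

Lemma hit_le U W x : W \subset U -> (0 < #|W|)%N -> hit U x <= H W x.
Proof.
move=> WU W0; have U0 := leq_trans W0 (subset_leq_card WU).
by rewrite /hit U0; have [_ _] := targetP x U0; apply.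
Qed.

Lemma hit_in U x : x \in U -> hit U x = 0.
Proof.
move=> xU; apply/le_anti; rewrite hit_ge0 andbT.
have U0 : (0 < #|U|)%N by apply/card_gt0P; exists x.
by rewrite -(H_in xU); exact: hit_le.
Qed.

(** The total of the hitting bounds met when the vertices of s are discovered in
    the order of s, the walk being at the first vertex of s. *)
Fixpoint cost s : R :=
  if s is y :: s' then hit [set z in s'] y + cost s' else 0.

Lemma cost_ge0 s : 0 <= cost s.
Proof. by elim: s => //= y s IH; rewrite addr_ge0 // hit_ge0. Qed.

Lemma cost_cat s1 s2 : (0 < size s2)%N ->
  cost (s1 ++ s2) <= \sum_(y <- s1) H [set z in s2] y + cost s2.
Proof.
move=> s20; elim: s1 => [|y s1 IH] /=; first by rewrite big_nil add0r.
rewrite big_cons -addrA; apply: lerD IH; apply: hit_le.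
  by apply/fintype.subsetP => z; rewrite !inE mem_cat => ->; rewrite orbT.
case: s2 s20 => // z s2 _; apply/card_gt0P; exists z.
by rewrite !inE eqxx.
Qed.

(** While the second half of the order is still undiscovered, the
    bounds met are at most those for hitting that half alone, and the sum of the
    latter over the first half is controlled by their average over the graph:
    however unlucky the order of discovery, few vertices are far from the many
    that remain. *)
Lemma cost_le s : uniq s ->
  cost s <= K0 * (#|G|%:R `^ b * (size s)%:R `^ (1 - b)).
Proof.
have [N] := ubnP (size s); elim: N s => // N IH s; rewrite ltnS => sN us.
have [s1|s2] := leqP (size s) 1.
  apply: (@le_trans _ _ 0); last by rewrite !mulr_ge0 // powR_ge0.
  case: s s1 {sN us} => [|y [|z s]] //= _.
  rewrite addr0 /hit; case: ifP => // /card_gt0P[z]; by rewrite !inE.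
set M := size s in sN s2 *.
pose s1 := take (M./2) s; pose s' := drop (M./2) s.
have sE : s = s1 ++ s' by rewrite cat_take_drop.
have size1 : size s1 = M./2.
  by rewrite size_take_min; apply/minn_idPl; rewrite -/M; lia.
have size2 : size s' = uphalf M.
  by rewrite size_drop -/M uphalf_half; have := odd_double_half M; lia.
have q0 : (0 < uphalf M)%N.
  by rewrite uphalf_half; move: s2; case: (M) => [|[|]] //=; lia.
have us' : uniq s' by rewrite drop_uniq.
have us1 : uniq s1 by rewrite take_uniq.
have card2 : #|[set z in s']| = uphalf M.
  by rewrite cardsE (card_uniqP us') size2.
have card1 : #|[set z in s1]| = M./2 by rewrite cardsE (card_uniqP us1) size1.
have q0' : (0 < #|[set z in s']|)%N by rewrite card2.
rewrite sE; apply: le_trans (cost_cat _ _) _; first by rewrite size2.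
have IH' := IH s' _ us'.
have sum1 : \sum_(y <- s1) H [set z in s'] y
   <= K * (#|G|%:R `^ b * (uphalf M)%:R `^ (1 - b)).
  rewrite -big_filter filter_predT big_uniq //=.
  have -> : \sum_(y in s1) H [set z in s'] y
          = \sum_(y in [set z in s1]) H [set z in s'] y.
    by apply: eq_bigl => y; rewrite inE.
  have le12 : (#|[set z in s1]| <= #|[set z in s']|)%N.
    by rewrite card1 card2 uphalf_half leq_addl.
  apply: le_trans (H_sum q0' le12) _; rewrite card2.
  apply: le_of_eq; congr (K * _).
  have qR : 0 < (uphalf M)%:R :> R by rewrite ltr0n.
  rewrite powRM ?invr_ge0 // mulrCA; congr (_ * _).
  rewrite powRD; last by rewrite (gt_eqF qR) implybT.
  by rewrite powRr1 // -powR_inv1 // -powRrM mulN1r.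
have {}IH' : cost s' <= K0 * (#|G|%:R `^ b * (uphalf M)%:R `^ (1 - b)).
  rewrite -size2; apply: IH'.
  rewrite size2; apply: leq_trans sN; rewrite uphalf_half.
  by have := odd_double_half M; lia.
apply: le_trans (lerD sum1 IH') _.
have := ler_wpM2l (powR_ge0 (#|G|%:R : R) b) (K0_rec s2).
lra.
Qed.

Lemma cost_le_card s : uniq s -> cost s <= K0 * #|G|%:R.
Proof.
move=> us; apply: le_trans (cost_le us) _; rewrite ler_wpM2l //.
have n0 : 0 < #|G|%:R :> R by rewrite ltr0n; exact: graph_inhabited.
apply: (@le_trans _ _ (#|G|%:R `^ b * #|G|%:R `^ (1 - b))).
  rewrite ler_wpM2l ?powR_ge0 // le_powR ?subr_ge0 //; first exact: ltW.
  by rewrite ler_nat -(card_uniqP us) max_card.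
rewrite -powRD; last by rewrite (gt_eqF n0) implybT.
by rewrite addrC subrK powRr1 // ltW.
Qed.

Definition worst_cost U : R :=
  \big[Num.max/0]_(s <- permutations (enum U)) cost s.

Lemma worst_cost_attained U : exists s,
  perm_eq s (enum U) /\ worst_cost U = cost s.
Proof.
have ex : permutations (enum U) != [::].
  by apply/eqP => e; have := perm_refl (enum U); rewrite -mem_permutations e.
suff [s sP ->] : exists2 s, s \in permutations (enum U) & worst_cost U = cost s.
  by exists s; rewrite -mem_permutations.
rewrite /worst_cost; elim: (permutations _) ex => // s [|s' S] IH _.
  exists s; first by rewrite inE.
  rewrite big_cons big_nil max_l //; exact: cost_ge0.
have [//|t tS e] := IH; rewrite big_cons e /Num.max; case: ifP => _.
  by exists t => //; rewrite in_cons tS orbT.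
by exists s => //; rewrite in_cons eqxx.
Qed.

Lemma cost_le_worst U s : perm_eq s (enum U) -> cost s <= worst_cost U.
Proof.
rewrite -mem_permutations /worst_cost.
elim: (permutations _) => // t S IH; rewrite inE big_cons le_max.
by case/predU1P => [->|/IH ->]; rewrite ?lexx ?orbT.
Qed.

Lemma worst_cost_ge0 U : 0 <= worst_cost U.
Proof. by have [s [_ ->]] := worst_cost_attained U; exact: cost_ge0. Qed.

Lemma worst_cost_le U : worst_cost U <= K0 * #|G|%:R.
Proof.
have [s [sU ->]] := worst_cost_attained U.
by apply: cost_le_card; rewrite (perm_uniq sU) enum_uniq.
Qed.

Lemma worst_cost_step U y : y \in U ->
  hit (U :\ y) y + worst_cost (U :\ y) <= worst_cost U.
Proof.
move=> yU; have [s [sU ->]] := worst_cost_attained (U :\ y).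
have mem_s z : (z \in s) = (z \in U :\ y) by rewrite (perm_mem sU) mem_enum.
have -> : U :\ y = [set z in s] by apply/setP => z; rewrite inE mem_s.
apply: (@cost_le_worst U (y :: s)); apply: uniq_perm => /=.
- by rewrite (perm_uniq sU) enum_uniq mem_s !inE eqxx.
- exact: enum_uniq.
move=> z; rewrite inE mem_s mem_enum !inE.
by case: eqVneq => // ->; rewrite yU.
Qed.

(** An upper bound for the expected remaining time when U is the set of
    unvisited vertices and the walk is at x. *)
Definition cover_potential U x : R := hit U x + worst_cost U.

Lemma cover_potential_ge0 U x : 0 <= cover_potential U x.
Proof. by rewrite addr_ge0 ?hit_ge0 ?worst_cost_ge0. Qed.

Lemma cover_potential_start v : cover_potential ([set: G] :\ v) v <= K0 * #|G|%:R.
Proof.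
apply: le_trans (worst_cost_step (finset.in_setT v)) _; exact: worst_cost_le.
Qed.

Variable eps : R.
Hypotheses (eps_ge0 : 0 <= eps) (eps_le1 : eps <= 1).
Hypothesis H_drift : forall W x, (0 < #|W|)%N -> x \notin W ->
  drift eps (H W) x.

Lemma hit_drift U x : (0 < #|U|)%N -> x \notin U -> drift eps (hit U) x.
Proof.
move=> U0 xU; have [tU t0 _] := targetP x U0.
have xt : x \notin target U x by apply: contra xU; exact: (fintype.subsetP tU).
have [u xu h] := H_drift t0 xt; exists u => //.
rewrite {3}/hit U0; apply: le_trans h; apply: lerD.
  by rewrite lerD2l ler_wpM2l ?subr_ge0 // le_avg // => y _; exact: hit_le.
by rewrite ler_wpM2l // hit_le.
Qed.

(** If the step discovers y, the decrease of worst_cost pays for the new hitting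
    bound, so the drift of the hitting bound of U suffices. *)
Lemma cover_potential_drift U x : (0 < #|U|)%N -> x \notin U ->
  exists2 u, adj x u &
    1 + (1 - eps) * avg (fun y => cover_potential (U :\ y) y) x
      + eps * cover_potential (U :\ u) u <= cover_potential U x.
Proof.
move=> U0 xU; have [u xu h] := hit_drift U0 xU; exists u => //.
have step y : cover_potential (U :\ y) y <= hit U y + worst_cost U.
  case: (boolP (y \in U)) => yU.
    by rewrite (hit_in yU) add0r; exact: worst_cost_step.
  rewrite /cover_potential (_ : U :\ y = U) //.
  by apply/finset.setDidPl; rewrite disjoint_sym disjoints1.
have a1 : avg (fun y => cover_potential (U :\ y) y) x
    <= avg (hit U) x + worst_cost U.
  apply: le_trans (le_avg (fun y _ => step y)) _.
  rewrite avgD lerD2l /avg sum_adj_const mulrAC divff ?mul1r //.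
  rewrite pnatr_eq0 -lt0n; apply/card_gt0P; exists u; exact: xu.
have eps1 : 0 <= 1 - eps by rewrite subr_ge0.
have := ler_wpM2l eps1 a1; have := ler_wpM2l eps_ge0 (step u).
rewrite /cover_potential; move: h; lra.
Qed.

End Cost.

(** Phi U x is meant for the set U of unvisited vertices and the current vertex x;
    a step to y removes y from U. *)
Definition is_cover_potential (R : realType) (eps : R) (G : graph)
    (Phi : {set G} -> G -> R) :=
  (forall (U : {set G}) (x : G), 0 <= Phi U x) /\
  forall (U : {set G}) (x : G), (0 < #|U|)%N -> x \notin U -> exists2 u, adj x u &
    1 + (1 - eps) * avg (fun y => Phi (U :\ y) y) x + eps * Phi (U :\ u) u
      <= Phi U x.

Theorem cover_potential_exists (R : realType) (mu eps : R) (D : nat) :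
  0 < mu -> mu < 1 -> 0 < eps -> eps <= 1 ->
  exists2 C : R, 0 < C & forall (G : graph) (k : nat),
    (forall x : G, degree x = k) -> (0 < k)%N -> (k <= D)%N -> contracts G mu ->
    exists Phi : {set G} -> G -> R, is_cover_potential eps Phi /\
      forall v, Phi ([set: G] :\ v) v <= C * #|G|%:R.
Proof.
move=> mu0 mu1 eps0 eps1.
pose b := hit_exponent eps; pose K := Num.max (hit_constant mu eps D) 0.
have b0 : 0 < b by exact: hit_exponent_gt0.
have b1 : b < 1 by exact: hit_exponent_lt1.
have K_ge0 : 0 <= K by rewrite le_max lexx orbT.
have [K0 K0_ge0 K0_rec] := cost_recursion b0 b1 K_ge0.
exists (K0 + 1) => [|G k degG k0 kD gapG]; first by rewrite ltr_wpDl.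
have ex (W : {set G}) : exists H : G -> R, (0 < #|W|)%N ->
    [/\ forall x, 0 <= H x, forall x, x \in W -> H x = 0,
        forall x, x \notin W -> drift eps H x
      & forall Y : {set G}, (#|Y| <= #|W|)%N ->
          \sum_(y in Y) H y <= K * (#|W|%:R * (#|G|%:R / #|W|%:R) `^ b)].
  have [W0|W0] := posnP #|W|; first by exists (fun=> 0).
  have [H [h1 h2 h3 h4]] := hitting_potential mu0 mu1 eps0 eps1 degG k0 kD gapG
    W0 (erefl (#|G|%:R / #|W|%:R)).
  exists H => _; split => // Y YW; apply: le_trans (h4 Y YW) _.
  by rewrite ler_wpM2r ?mulr_ge0 ?powR_ge0 // le_max lexx.
have [H HP] := choice ex.
have H_ge0 (W : {set G}) x : (0 < #|W|)%N -> 0 <= H W x by case/HP.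
have H_in (W : {set G}) x : x \in W -> H W x = 0.
  move=> xW; have W0 : (0 < #|W|)%N by apply/card_gt0P; exists x.
  by case: (HP W W0) => _ h _ _; exact: h.
have H_drift (W : {set G}) x : (0 < #|W|)%N -> x \notin W -> drift eps (H W) x.
  by case/HP => _ _ h _; exact: h.
have H_sum (W Y : {set G}) : (0 < #|W|)%N -> (#|Y| <= #|W|)%N ->
  \sum_(y in Y) H W y <= K * (#|W|%:R * (#|G|%:R / #|W|%:R) `^ b).
  by case/HP => _ _ _; exact.
exists (cover_potential H); split; first split.
- by move=> U x; exact: cover_potential_ge0.
- by move=> U x U0 xU; apply: cover_potential_drift => //; exact: ltW.
move=> v; apply: le_trans (_ : _ <= K0 * #|G|%:R) _.
  exact: (cover_potential_start b0 b1 K0_ge0 K0_rec H_ge0 H_sum).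
by rewrite ler_wpM2r // lerDl.
Qed.

(** * Realizing the biased walk on the unit interval *)

Section Subdivision.
Context {R : realType} {V : finType}.
Variable q : V -> R.
Hypotheses (q_ge0 : forall u, 0 <= q u) (q_sum1 : \sum_u q u = 1).

Definition cumul (j : nat) : R := \sum_(u | (enum_rank u < j)%N) q u.

Lemma cumulS u : cumul (enum_rank u).+1 = cumul (enum_rank u) + q u.
Proof.
rewrite /cumul (bigD1 u) //= addrC; congr (_ + _); apply: eq_bigl => y.
by rewrite ltnS ltn_neqAle (inj_eq (@ord_inj _)) (inj_eq (@enum_rank_inj _)) andbC.
Qed.

Lemma le_cumul i j : (i <= j)%N -> cumul i <= cumul j.
Proof.
move=> ij; rewrite /cumul [leRHS](bigID (fun u => enum_rank u < i)%N) /=.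
rewrite -[leLHS]addr0; apply: lerD; last by apply: sumr_ge0.
rewrite le_eqVlt; apply/orP; left; apply/eqP/eq_bigl => u.
by case: (ltnP (enum_rank u) i) => h; rewrite ?andbF // andbT (leq_trans h ij).
Qed.

Lemma cumul_ge0 j : 0 <= cumul j. Proof. exact: sumr_ge0. Qed.

Lemma cumul_full : cumul #|V| = 1.
Proof. by rewrite -q_sum1; apply: eq_bigl => u; rewrite ltn_ord. Qed.

Lemma cumulS_le1 u : cumul (enum_rank u) + q u <= 1.
Proof. by rewrite -cumulS -cumul_full le_cumul. Qed.

Variables (a l w : R).
Hypothesis l_ge0 : 0 <= l.

(** The interval [a, a + l[ cut into pieces of relative lengths q u. *)
Definition piece u : bool :=
  (a + l * cumul (enum_rank u) <= w) && (w < a + l * (cumul (enum_rank u) + q u)).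

Lemma piece_sub u : piece u -> (a <= w) && (w < a + l).
Proof.
move=> /andP[h1 h2]; apply/andP; split.
  by apply: le_trans h1; rewrite lerDl mulr_ge0 // cumul_ge0.
apply: lt_le_trans h2 _; rewrite lerD2l ler_piMr //; exact: cumulS_le1.
Qed.

Lemma piece_exists : (a <= w) && (w < a + l) -> exists u, piece u.
Proof.
move=> /andP[aw wl].
have : w < a + l * cumul #|V| by rewrite cumul_full mulr1.
elim: {-2}#|V| (leqnn #|V|) => [|N IH] NV h.
  move: h; rewrite /cumul big_pred0; last by move=> u; rewrite ltn0.
  by rewrite mulr0 addr0 ltNge aw.
have [h'|h'] := ltP w (a + l * cumul N); first exact: IH (ltnW NV) h'.
exists (enum_val (Ordinal NV)); rewrite /piece -cumulS enum_valK.
by rewrite h' h.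
Qed.

Lemma piece_inj u u' : piece u -> piece u' -> u = u'.
Proof.
have lt_no y y' : piece y -> piece y' -> ~~ (enum_rank y < enum_rank y')%N.
  move=> /andP[_ h1] /andP[h2 _]; apply/negP => yy'.
  have := lt_le_trans h1 (le_refl _); rewrite -cumulS => h3.
  have := le_lt_trans h2 h3; apply/negP; rewrite -leNgt lerD2l ler_wpM2l //.
  exact: le_cumul.
move=> pu pu'; apply: enum_rank_inj; apply/val_inj/eqP => /=.
have := lt_no _ _ pu pu'; have := lt_no _ _ pu' pu; rewrite -!leqNgt.
by rewrite eqn_leq => -> ->.
Qed.

End Subdivision.

Section Realization.
Context {R : realType} {V : finType}.
Variables (p : seq V -> V -> R) (v : V).
Hypothesis p_ge0 : forall h x u, 0 <= p (rcons h x) u.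
Hypothesis p_sum1 : forall h x, \sum_u p (rcons h x) u = 1.
Implicit Types (h : seq V) (w : R) (u x : V) (t : nat).

(** Histories are kept most recent vertex first. The history h is realized on
    the interval [lo h, lo h + len h[, of length the probability of h. *)
Fixpoint len h : R :=
  match h with
  | [::] => 1
  | u :: h' => if h' is [::] then 1 else len h' * p (rev h') u
  end.

Fixpoint lo h : R :=
  match h with
  | [::] => 0
  | u :: h' => if h' is [::] then 0
      else lo h' + len h' * cumul (p (rev h')) (enum_rank u)
  end.

Definition in_hist h w : bool := (lo h <= w) && (w < lo h + len h).

Fixpoint trace w t : seq V :=
  if t is t'.+1 then
    let h := trace w t' in
    odflt v [pick u | piece (p (rev h)) (lo h) (len h) w u] :: h
  else [:: v].

(* Points outside [0, 1[ have probability 0; there the walk stays at v. *)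
Definition walk t w : V :=
  if (0 <= w) && (w < 1) then head v (trace w t) else v.

Let p_rev_ge0 h u x : 0 <= p (rev (x :: h)) u.
Proof. by rewrite rev_cons. Qed.

Let p_rev_sum1 h x : \sum_u p (rev (x :: h)) u = 1.
Proof. by rewrite rev_cons. Qed.

Lemma len_ge0 h : 0 <= len h.
Proof.
by elim: h => //= u [|x h] //= IH; rewrite mulr_ge0.
Qed.

Lemma in_histS u x h w : in_hist (u :: x :: h) w =
  piece (p (rev (x :: h))) (lo (x :: h)) (len (x :: h)) w u.
Proof. by rewrite /in_hist /piece mulrDr addrA. Qed.

Lemma size_trace w t : size (trace w t) = t.+1.
Proof. by elim: t => //= t ->. Qed.

Lemma trace_in w t : 0 <= w < 1 -> in_hist (trace w t) w.
Proof.
move=> w01; elim: t => [|t IH] /=; first by rewrite /in_hist /= add0r.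
have := size_trace w t; case: (trace w t) IH => // x h IH _.
rewrite in_histS; case: pickP => [u //|no].
have [u pu] := piece_exists (p_rev_sum1 h x) IH.
by rewrite no in pu.
Qed.

(** The pieces of the interval of a history are the intervals of its one-step
    extensions, so a point follows exactly the histories whose interval contains
    it. *)
Lemma trace_eq w t h : 0 <= w < 1 -> size h = t.+1 -> last v h = v ->
  (trace w t == h) = in_hist h w.
Proof.
move=> w01; elim: t h => [|t IH] [|u h] //= [sh] lastv.
  by move: sh lastv => /eqP; rewrite size_eq0 => /eqP -> /= ->;
    rewrite eqxx /in_hist /= add0r w01.
case: h sh lastv => // x h sh lastv.
rewrite in_histS eqseq_cons (IH (x :: h)) //.
apply/andP/idP => [[/eqP <- eh]|pu].
  have trE : trace w t = x :: h by apply/eqP; rewrite IH.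
  rewrite trE; case: pickP => // no.
  have [y py] := piece_exists (p_rev_sum1 h x) eh.
  by rewrite no in py.
have eh : in_hist (x :: h) w.
  exact: (piece_sub (p_rev_ge0 h ^~ x) (p_rev_sum1 h x) (len_ge0 _) pu).
split=> //; have trE : trace w t = x :: h by apply/eqP; rewrite IH.
rewrite trE; case: pickP => [y py|/(_ u)]; last by rewrite pu.
by apply/eqP; apply: piece_inj py pu; rewrite ?len_ge0.
Qed.

Lemma in_hist_sub h w : in_hist h w -> 0 <= w < 1.
Proof.
elim: h => [|u [|x h] IH]; try by rewrite /in_hist /= add0r.
rewrite in_histS => pu; apply: IH.
exact: (piece_sub (p_rev_ge0 h ^~ x) (p_rev_sum1 h x) (len_ge0 _) pu).
Qed.

Lemma last_trace w t : last v (trace w t) = v.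
Proof. by elim: t => //= t; have := size_trace w t; case: (trace w t). Qed.

Lemma trace_walk w t : 0 <= w < 1 -> trace w t = rev (mkseq (walk ^~ w) t.+1).
Proof.
move=> w01; elim: t => [|t IH]; first by rewrite /= /walk w01.
by rewrite mkseqS rev_rcons -IH /walk w01.
Qed.

Lemma walk_path w t (x : nat -> V) : 0 <= w < 1 ->
  (forall i, (i <= t)%N -> walk i w = x i) <->
  trace w t = rev (mkseq x t.+1).
Proof.
move=> w01; rewrite trace_walk //; split => [h|/(can_inj revK) h i it].
  congr rev; apply/eq_in_map => i; rewrite mem_iota add0n => /andP[_ it].
  exact: h.
have := congr1 (fun s => nth v s i) h.
by rewrite !nth_mkseq ?ltnS.
Qed.

End Realization.

Local Open Scope classical_set_scope.

Section RealizationMeasure.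
Context {R : realType} {V : finType}.
Variables (p : seq V -> V -> R) (v : V).
Hypothesis p_ge0 : forall h x u, 0 <= p (rcons h x) u.
Hypothesis p_sum1 : forall h x, \sum_u p (rcons h x) u = 1.

Let unit_itv : set R := `[0%R, 1%R[.

Let unit_itv_measurable : measurable unit_itv.
Proof. exact: measurable_itv. Qed.

Definition unit_law : set _ -> \bar R :=
  mrestr (@lebesgue_measure R) unit_itv_measurable.

HB.instance Definition _ := Measure.copy unit_law
  (mrestr (@lebesgue_measure R) unit_itv_measurable).

Let unit_law_setT : unit_law setT = 1%E.
Proof.
rewrite /unit_law /mrestr setTI /unit_itv lebesgue_measure_itv /= lte_fin ltr01.
by rewrite -EFinB subr0.
Qed.

HB.instance Definition _ := Measure_isProbability.Build _ _ _ unit_law unit_law_setT.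

Let hist_set (h : seq V) : set R := `[lo p h, (lo p h + len p h)[.

Let hist_setE h w : hist_set h w = in_hist p h w.
Proof. by rewrite /hist_set /mkset in_itv. Qed.

Let unitE w : unit_itv w = (0 <= w < 1).
Proof. by rewrite /unit_itv /mkset in_itv. Qed.

Let walk_measurable t u : measurable [set w | walk p v t w = u].
Proof.
pose good (h : t.+1.-tuple V) := (head v h == u) && (last v h == v).
have -> : [set w | walk p v t w = u]
  = \bigcup_(h in [set h : t.+1.-tuple V | good h]) hist_set h
    `|` (if u == v then ~` unit_itv else set0).
  apply/seteqP; split => w /=.
    case: (boolP (0 <= w < 1)) => w01; last first.
      rewrite /walk (negbTE w01) => <-; right; rewrite eqxx => /=.
      by rewrite unitE; exact/negP.
    rewrite /walk w01 => hu; left.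
    exists (tcast (size_trace p v w t) (in_tuple (trace p v w t))) => /=.
      by rewrite /good val_tcast /= hu last_trace !eqxx.
    by rewrite hist_setE val_tcast /= trace_in.
  case => [[h /andP[/eqP hu /eqP hv]]|].
    rewrite hist_setE => hw; have w01 := in_hist_sub p_ge0 p_sum1 hw.
    rewrite /walk w01 -hu; congr head; apply/eqP.
    by rewrite trace_eq // size_tuple.
  case: eqP => // -> /=; rewrite unitE => /negP w01.
  by rewrite /walk (negbTE w01).
apply: measurableU; last by case: ifP => // _; exact: measurableC.
apply: fin_bigcup_measurable => [|h _]; first exact: finite_finset.
exact: measurable_itv.
Qed.

Let walk_law t (x : nat -> V) :
  unit_law [set w | forall i, (i <= t)%N -> walk p v i w = x i]
  = ((x 0%N == v)%:R * len p (rev (mkseq x t.+1)))%:E.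
Proof.
rewrite /unit_law /mrestr.
case: eqP => x0; last first.
  rewrite mul0r (_ : _ `&` _ = set0) ?measure0 //.
  apply/seteqP; split => w //= [h w01]; apply: x0; rewrite -h //.
  by rewrite /walk; case: ifP.
rewrite mul1r.
have -> : [set w | forall i, (i <= t)%N -> walk p v i w = x i] `&` unit_itv
   = hist_set (rev (mkseq x t.+1)).
  have sz : size (rev (mkseq x t.+1)) = t.+1 by rewrite size_rev size_mkseq.
  have lst : last v (rev (mkseq x t.+1)) = v.
    by rewrite /mkseq /= rev_cons last_rcons.
  apply/seteqP; split => w /=; rewrite hist_setE.
    move=> [h]; rewrite unitE => w01; rewrite -(trace_eq p_ge0 p_sum1 w01 sz lst).
    exact/eqP/walk_path.
  move=> hw; have w01 := in_hist_sub p_ge0 p_sum1 hw.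
  split; last by rewrite unitE.
  apply/walk_path => //; apply/eqP; by rewrite trace_eq.
rewrite lebesgue_measure_itv /= lte_fin; case: ifP => h.
  by rewrite -EFinB addrAC subrr add0r.
move: h; rewrite ltrDl => h; congr EFin; apply/le_anti.
by rewrite len_ge0 // leNgt h.
Qed.

Lemma realization : exists (d : measure_display) (T : measurableType d)
    (P : probability T R) (X : nat -> T -> V),
  [/\ forall t u, measurable [set w | X t w = u],
      P [set w | X 0%N w = v] = 1%E
    & forall (t : nat) (x : nat -> V),
        P [set w | forall i, (i <= t.+1)%N -> X i w = x i] =
        (P [set w | forall i, (i <= t)%N -> X i w = x i] *
         (p (mkseq x t.+1) (x t.+1))%:E)%E].
Proof.
exists _, _, unit_law, (walk p v); split => [t u||t x].
- exact: walk_measurable.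
- have := walk_law 0 (fun=> v); rewrite /= eqxx mulr1 => <-.
  congr (unit_law _); apply/seteqP; split => w /= h; last exact: h.
  by move=> i; rewrite leqn0 => /eqP ->.
- rewrite [LHS](walk_law t.+1 x) [X in (X * _)%E](walk_law t x).
  rewrite -EFinM [in LHS]mkseqS rev_rcons -mulrA.
  congr ((_ * _)%:E); rewrite -{3}(revK (mkseq x t.+1)) /=.
  by case: (rev (mkseq x t.+1)) (size_rev (mkseq x t.+1)) => //; rewrite size_mkseq.
Qed.

End RealizationMeasure.

(** * The expected cover time *)

Section CoverTime.
Context {R : realType} {G : graph} {T : Type}.
Variable X : nat -> T -> G.
Implicit Types (w : T) (t : nat) (h : seq G) (u : G).

(** The trajectory up to time t, most recent vertex first. *)
Definition past w t : seq G := rev (mkseq (X ^~ w) t.+1).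

Definition unfinished h : bool := [exists u, u \notin h].

Lemma pastS w t : past w t.+1 = X t.+1 w :: past w t.
Proof. by rewrite /past mkseqS rev_rcons. Qed.

Lemma mem_past w t u : reflect (exists2 s, (s <= t)%N & X s w = u) (u \in past w t).
Proof.
rewrite /past mem_rev; apply: (iffP mapP) => [[s]|[s st <-]].
  by rewrite mem_iota add0n => /andP[_ st] ->; exists s.
by exists s; rewrite // mem_iota add0n.
Qed.

Lemma unfinishedP w t :
  ~~ unfinished (past w t) <-> forall u, exists2 s, (s <= t)%N & X s w = u.
Proof.
rewrite /unfinished negb_exists; split => [/forallP h u|h].
  by apply/mem_past; have := h u; rewrite negbK.
by apply/forallP => u; rewrite negbK; apply/mem_past.
Qed.

Lemma unfinished_anti w s t : (s <= t)%N ->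
  unfinished (past w t) -> unfinished (past w s).
Proof.
move=> st; apply: contraLR => /unfinishedP h; apply/unfinishedP => u.
by have [i iS Xi] := h u; exists i => //; exact: leq_trans st.
Qed.

(** Counting the times at which some vertex is unvisited makes the expectation a
    sum over events that depend on finite histories only. *)
Lemma cover_time_series w :
  (cover_time R X w = \sum_(0 <= t <oo) ((unfinished (past w t))%:R : R)%:E)%E.
Proof.
have term0 t : (0 <= ((unfinished (past w t))%:R : R)%:E)%E by rewrite lee_fin.
have [ex|never] := pselect (exists t, ~~ unfinished (past w t)).
  pose t0 := ex_minn ex.
  have [done0 min0] : ~~ unfinished (past w t0) /\
      forall t, ~~ unfinished (past w t) -> (t0 <= t)%N.
    by rewrite /t0; case: ex_minnP.
  rewrite (nneseries_split 0 t0) //= add0n [X in (_ + X)%E]eseries0; last first.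
    move=> t t0t _; rewrite (_ : unfinished _ = false) //; apply/negbTE.
    by apply: contra done0; exact: unfinished_anti.
  rewrite adde0 (eq_big_nat _ _ (F2 := fun=> 1%E)); last first.
    move=> t /andP[_ tt0]; case: (boolP (unfinished _)) => // /min0.
    by rewrite leqNgt tt0.
  rewrite -[X in X%R = _]/(cover_time R X w).
  have -> : (\sum_(0 <= i < t0) (1 : \bar R) = t0%:R%:E)%E.
    by rewrite sumEFin big_nat_cond -big_nat_cond sumr_const_nat subn0.
  apply/le_anti/andP; split.
    by apply: ereal_inf_lbound; exists t0 => //; apply/unfinishedP.
  apply: le_ereal_inf_tmp => _ [t /= ht <-]; rewrite lee_fin ler_nat.
  by apply: min0; apply/unfinishedP.
rewrite /cover_time (_ : [set _ | t in _] = set0); last first.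
  rewrite -subset0 => _ [t /= ht _]; apply: never; exists t.
  exact/unfinishedP.
rewrite ereal_inf0; apply/esym/eqyP => A A0.
apply: le_trans (nneseries_lim_ge (Num.truncn A).+1 (fun t _ _ => term0 t)).
rewrite (eq_big_nat _ _ (F2 := fun=> 1%E)); last first.
  move=> t _; case: (boolP (unfinished _)) => // h.
  by case: never; exists t.
rewrite sumEFin lee_fin sumr_const_nat subn0; exact: ltW (truncnS_gt _).
Qed.

End CoverTime.

Section Law.
Context {R : realType} {G : graph}.
Variables (eps : R) (sigma : seq G -> G -> R) (v : G).
Implicit Types (h : seq G) (u x : G) (t : nat).

(** The law of the next vertex given the history h, earliest vertex first. *)
Definition next_law h u : R := tb_step eps sigma h (last v h) u.

(** The probability of a history, most recent vertex first. *)
Fixpoint weight h : R :=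
  match h with
  | [::] => 1
  | u :: h' => if h' is [::] then (u == v)%:R else weight h' * next_law (rev h') u
  end.

Fixpoint histories t : seq (seq G) :=
  if t is t'.+1 then [seq u :: h | h <- histories t', u <- enum G]
  else [seq [:: u] | u <- enum G].

Definition mean t (f : seq G -> R) : R := \sum_(h <- histories t) weight h * f h.

Lemma size_histories t h : h \in histories t -> size h = t.+1.
Proof.
elim: t h => [|t IH] h /=; first by move=> /mapP[u _ ->].
by move=> /allpairsP[[h' u] /= [/IH <- _ ->]].
Qed.

Lemma uniq_histories t : uniq (histories t).
Proof.
elim: t => [|t IH] /=.
  by rewrite map_inj_uniq ?enum_uniq // => x y [].
apply: allpairs_uniq => //; first exact: enum_uniq.
by move=> [h u] [h' u'] _ _ [-> ->].
Qed.

Lemma past_histories T (X : nat -> T -> G) w t : past X w t \in histories t.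
Proof.
elim: t => [|t IH]; first by apply: map_f; rewrite mem_enum.
by rewrite pastS /=; apply: (allpairs_f (fun h u => u :: h)); rewrite ?mem_enum.
Qed.

Lemma mean0 f : mean 0 f = f [:: v].
Proof.
rewrite /mean big_map big_enum /= (bigD1 v) //= eqxx mul1r big1 ?addr0 //.
by move=> u /negbTE ->; rewrite mul0r.
Qed.

Lemma meanS t f :
  mean t.+1 f = mean t (fun h => \sum_u next_law (rev h) u * f (u :: h)).
Proof.
rewrite /mean /= big_allpairs_dep; apply: eq_big_seq => h /size_histories.
case: h => // x h _; rewrite mulr_sumr big_enum; apply: eq_bigr => u _.
by rewrite /= mulrA.
Qed.

Hypotheses (eps_ge0 : 0 <= eps) (eps_le1 : eps <= 1) (sigma_ok : strategy sigma).
Hypothesis deg_gt0 : forall x : G, (0 < degree x)%N.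

Lemma next_law_ge0 h x u : 0 <= next_law (rcons h x) u.
Proof.
have [s0 _ _] := sigma_ok h x.
by rewrite addr_ge0 // mulr_ge0 ?divr_ge0 ?subr_ge0.
Qed.

Lemma next_law_sum h x (F : G -> R) : \sum_u next_law (rcons h x) u * F u =
  (1 - eps) * avg F x + eps * \sum_u sigma (rcons h x) u * F u.
Proof.
rewrite avgE !mulr_sumr -big_split; apply: eq_bigr => u _ /=.
by rewrite /next_law /tb_step last_rcons; ring.
Qed.

Lemma next_law_sum1 h x : \sum_u next_law (rcons h x) u = 1.
Proof.
have := next_law_sum h x (fun=> 1); have [_ _ s1] := sigma_ok h x.
under eq_bigr do rewrite mulr1; move=> ->.
under [in X in _ + X]eq_bigr do rewrite mulr1.
rewrite s1 /avg sum_adj_const mulr1 divff ?pnatr_eq0 -?lt0n //; ring.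
Qed.

Lemma weight_ge0 h : 0 <= weight h.
Proof.
elim: h => //= u [|x h] IH; first by rewrite ler0n.
by rewrite mulr_ge0 // rev_cons next_law_ge0.
Qed.

Lemma le_mean t f g : (forall h, size h = t.+1 -> f h <= g h) ->
  mean t f <= mean t g.
Proof.
move=> fg; rewrite /mean big_seq [leRHS]big_seq; apply: ler_sum => h hh.
by rewrite ler_wpM2l ?weight_ge0 // fg // (size_histories hh).
Qed.

Lemma meanD t f g : mean t (fun h => f h + g h) = mean t f + mean t g.
Proof. by rewrite /mean -big_split; apply: eq_bigr => h _ /=; rewrite mulrDr. Qed.

Context {d : measure_display} {T : measurableType d} (P : probability T R).
Variable X : nat -> T -> G.
Hypothesis X_walk : is_TBRW eps sigma v P X.

Lemma past_measurable t h : measurable [set w | past X w t = h].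
Proof.
have [mX _ _] := X_walk.
elim: t h => [|t IH] [|u h].
- by rewrite (_ : [set _ | _] = set0) //; apply/seteqP; split.
- case: h => [|y h].
    rewrite (_ : [set _ | _] = [set w | X 0%N w = u]) //.
    have p0 w : past X w 0 = [:: X 0%N w] by [].
    apply/seteqP; split => w; rewrite /mkset p0; first by case.
    by move=> <-.
  by rewrite (_ : [set _ | _] = set0) //; apply/seteqP; split.
- rewrite (_ : [set _ | _] = set0) //; apply/seteqP; split => // w /=.
  by rewrite pastS.
- rewrite (_ : [set _ | _] = [set w | X t.+1 w = u] `&` [set w | past X w t = h]).
    exact: measurableI.
  apply/seteqP; split => w /=; first by rewrite pastS => -[].
  by rewrite pastS => -[-> ->].
Qed.

Lemma path_prob t (x : nat -> G) :
  P [set w | forall i, (i <= t)%N -> X i w = x i]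
    = (weight (rev (mkseq x t.+1)))%:E.
Proof.
have [mX P0 PS] := X_walk; elim: t => [|t IH].
  rewrite (_ : [set _ | _] = [set w | X 0%N w = x 0%N]); last first.
    apply/seteqP; split => w /= h; first exact: h.
    by move=> i; rewrite leqn0 => /eqP ->.
  rewrite /=; case: eqP => [->//|x0].
  apply/le_anti; rewrite measure_ge0 andbT.
  apply: (@le_trans _ _ (P (~` [set w | X 0%N w = v]))).
    apply: le_measure; rewrite ?inE //; first exact: measurableC.
    by move=> w /= hx h; apply: x0; exact: etrans (esym hx) h.
  by rewrite probability_setC // P0 -EFinB subrr.
rewrite PS IH -EFinM [in RHS]mkseqS rev_rcons; congr EFin.
have -> : tb_step eps sigma (mkseq x t.+1) (x t) (x t.+1)
   = next_law (rev (rev (mkseq x t.+1))) (x t.+1).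
  by rewrite revK /next_law mkseqS last_rcons.
by rewrite /=; case: (rev (mkseq x t.+1)) (size_rev (mkseq x t.+1)).
Qed.

Lemma past_prob t h : size h = t.+1 ->
  P [set w | past X w t = h] = (weight h)%:E.
Proof.
move=> sh; pose x i := nth v (rev h) i.
have hE : rev (mkseq x t.+1) = h.
  by rewrite -sh -size_rev /x mkseq_nth revK.
rewrite -[in RHS]hE -path_prob; congr (P _); apply/seteqP; split => w /=.
  move=> e i it; have := congr1 (fun s => nth v (rev s) i) e.
  by rewrite /past revK nth_mkseq ?ltnS.
move=> e; rewrite -hE /past; congr rev; apply/eq_in_map => i.
by rewrite mem_iota add0n => /andP[_ it]; exact: e.
Qed.

Lemma integral_past t (f : seq G -> R) : (forall h, 0 <= f h) ->
  (\int[P]_w (f (past X w t))%:E = (mean t f)%:E)%E.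
Proof.
move=> f0; pose A h : set T := [set w | past X w t = h].
have mA h : measurable (A h) := past_measurable t h.
have m1 h : measurable_fun setT (EFin \o (\1_(A h) : T -> R)).
  apply/measurable_EFinP; exact: measurable_indic.
have ind0 h w : (0 <= (\1_(A h) w : R)%:E)%E by rewrite lee_fin indicE.
transitivity (\int[P]_w
    (\sum_(h <- histories t) ((f h)%:E * (\1_(A h) w)%:E)))%E.
  apply: eq_integral => w _.
  rewrite (bigD1_seq (past X w t)) /= ?past_histories ?uniq_histories //.
  rewrite indicE mem_set // mule1 big1 ?adde0 // => h hw.
  rewrite indicE memNset ?mule0 // /A /= => e.
  by move: hw; rewrite e eqxx.
rewrite ge0_integral_sum //; last 2 first.
- by move=> h; apply: measurable_funeM; exact: m1.
- by move=> h w _; rewrite mule_ge0 // lee_fin.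
rewrite /mean -sumEFin; apply: eq_big_seq => h hh.
rewrite (ge0_integralZl P measurableT (m1 h) (fun w _ => ind0 h w)) ?lee_fin //.
rewrite [X in (_ * X)%E](_ : _ = P (A h)).
  by rewrite (past_prob (size_histories hh)) -EFinM mulrC.
by rewrite -[A h in RHS]setIT -integral_indic.
Qed.

Lemma expected_cover_time : (\int[P]_w cover_time R X w
  = \sum_(0 <= t <oo) (mean t (fun h => (unfinished h)%:R))%:E)%E.
Proof.
under eq_integral do rewrite cover_time_series.
have mf t : measurable_fun setT
    (EFin \o (fun w => (unfinished (past X w t))%:R : R)).
  apply/measurable_EFinP.
  rewrite (_ : (fun _ => _) = \1_([set w | unfinished (past X w t)])); last first.
    apply/funext => w; rewrite indicE; case: (boolP (unfinished _)) => h.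
      by rewrite mem_set.
    by rewrite memNset //=; exact/negP.
  apply: measurable_indic.
  rewrite (_ : [set _ | _] = \bigcup_(h in [set h | h \in
      [seq h <- histories t | unfinished h]]) [set w | past X w t = h]).
    apply: fin_bigcup_measurable => [|h _]; first exact: finite_seq.
    exact: past_measurable.
  apply/seteqP; split => w /=.
    move=> h; exists (past X w t) => //=.
    by rewrite mem_filter h past_histories.
  by move=> [h /=]; rewrite mem_filter => /andP[hu _] ->.
have f0 t w : setT w -> (0 <= ((unfinished (past X w t))%:R : R)%:E)%E.
  by rewrite lee_fin.
rewrite (integral_nneseries P measurableT mf f0).
apply: eq_eseriesr => t _.
by rewrite -(@integral_past t (fun h => (unfinished h)%:R)).
Qed.

(** Up to time t at most t + 1 vertices are seen, so the first #|G| - 1 terms of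
    the series are 1. *)
Lemma expected_cover_time_ge : ((#|G|.-1%:R)%:E <= \int[P]_w cover_time R X w)%E.
Proof.
rewrite expected_cover_time.
have mean_ge0 t : (0 <= (mean t (fun h => (unfinished h)%:R))%:E)%E.
  by rewrite lee_fin sumr_ge0 // => h _; rewrite mulr_ge0 ?weight_ge0.
apply: le_trans (nneseries_lim_ge #|G|.-1 (fun t _ _ => mean_ge0 t)).
rewrite sumEFin lee_fin big_nat_cond.
rewrite (eq_bigr (fun=> 1)); last first.
  move=> t /andP[/andP[_ tG] _]; rewrite /mean big_seq.
  rewrite (eq_bigr (fun h => weight h * 1)); last first.
    move=> h /size_histories sh; rewrite (_ : unfinished h = true) //.
    apply: contraT; rewrite negb_exists.
    move=> /forallP all_in.
    have : (#|G| <= size h)%N.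
      apply: leq_trans (card_size h); apply/subset_leq_card.
      by apply/fintype.subsetP => u _; have := all_in u; rewrite negbK.
    by rewrite sh leqNgt -ltn_predRL tG.
  rewrite -big_seq; change (mean t (fun=> 1) = 1).
  elim: t {tG} => [|t IH]; first exact: mean0.
  rewrite meanS -[RHS]IH; apply: eq_big_seq => h /size_histories.
  case/lastP: h => [//|h x _]; congr (_ * _).
  under eq_bigr do rewrite mulr1.
  have : (0 < size (rev (rcons h x)))%N by rewrite size_rev size_rcons.
  by case/lastP: (rev _) => // h' x' _; exact: next_law_sum1.
by rewrite -big_nat_cond sumr_const_nat subn0.
Qed.

(** The potential of the current state plus the elapsed uncovered time is a
    supermartingale. *)
Lemma expected_cover_time_le (Phi : {set G} -> G -> R) :
  (forall U x, 0 <= Phi U x) ->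
  (forall h x, let U := ~: [set z in rcons h x] in (0 < #|U|)%N ->
     1 + \sum_u next_law (rcons h x) u * Phi (U :\ u)%SET u <= Phi U x) ->
  (\int[P]_w cover_time R X w <= (Phi ([set: G] :\ v)%SET v)%:E)%E.
Proof.
move=> Phi0 PhiS.
(* The drift of Phi stops once all vertices are visited, hence the cut-off. *)
pose F h : R := if unfinished h then Phi (~: [set z in h])%SET (head v h) else 0.
have F0 h : 0 <= F h by rewrite /F; case: ifP.
have unf h : unfinished h = (0 < #|~: [set z in h]|)%N.
  rewrite card_gt0; apply/existsP/set0Pn => -[u]; rewrite ?inE => hu;
  by exists u; rewrite ?inE.
have step t : mean t.+1 F + mean t (fun h => (unfinished h)%:R) <= mean t F.
  rewrite meanS -meanD; apply: le_mean => -[//|x h] _.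
  rewrite rev_cons.
  have sub u : unfinished (u :: x :: h) -> unfinished (x :: h).
    move=> /existsP[y]; rewrite inE negb_or => /andP[_ hy].
    by apply/existsP; exists y.
  case: (boolP (unfinished (x :: h))) => hx; last first.
    rewrite addr0 big1 // => u _; rewrite /F ifN ?mulr0 //.
    exact: contra (sub u) hx.
  have UE : ~: [set z in x :: h] = ~: [set z in rcons (rev h) x].
    by apply/setP => z; rewrite !inE mem_rcons inE mem_rev.
  rewrite addrC {2}/F hx /= UE.
  have U0 : (0 < #|~: [set z in rcons (rev h) x]|)%N by rewrite -UE -unf.
  apply: le_trans (PhiS _ _ U0); rewrite lerD2l; apply: ler_sum => u _.
  rewrite ler_wpM2l ?next_law_ge0 // /F; case: ifP => _ //=.
  rewrite (_ : ~: [set z in u :: x :: h] = ~: [set z in rcons (rev h) x] :\ u) //.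
  by rewrite -UE; apply/setP => z; rewrite !inE negb_or.
have sums N : \sum_(0 <= t < N) mean t (fun h => (unfinished h)%:R)
    + mean N F <= mean 0 F.
  elim: N => [|N IH]; first by rewrite big_geq // add0r.
  apply: le_trans IH; rewrite big_nat_recr //= -addrA lerD2l addrC.
  exact: step.
rewrite expected_cover_time; apply: lime_le.
  apply: is_cvg_nneseries => t _ _.
  by rewrite lee_fin sumr_ge0 // => h _; rewrite mulr_ge0 ?weight_ge0.
apply: nearW => N; rewrite sumEFin lee_fin.
apply: (@le_trans _ _ (mean 0 F)).
  apply: le_trans (sums N); rewrite lerDl.
  by apply: sumr_ge0 => h _; rewrite mulr_ge0 ?weight_ge0.
rewrite mean0 /F; case: ifP => // _ /=.
rewrite (_ : ~: [set z in [:: v]] = ([set: G] :\ v)%SET) //.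
by apply/setP => z; rewrite !inE andbT.
Qed.

End Law.

(** * Linear cover time *)

Lemma degree_gt0 (G : graph) (x : G) : (1 < #|G|)%N -> (0 < degree x)%N.
Proof.
move=> G1; have [y yx] : exists y : G, y != x.
  apply/existsP; rewrite -negb_forall; apply: contraTN G1 => /forallP all_x.
  rewrite -leqNgt -(card1 x); apply/subset_leq_card/fintype.subsetP => y _.
  by rewrite inE all_x.
have /connectP[[|u s] /= su yE] := graph_connected x y.
  by rewrite yE eqxx in yx.
by move: su => /andP[xu _]; apply/card_gt0P; exists u.
Qed.

Lemma vertex_expansion_expanding (R : realType) (G : graph) (psi : R) :
  (psi%:E <= vertex_expansion R G)%E -> @expanding R G psi.
Proof.
move=> le_psi S S0 S2.
have n0 : 0 < #|G|%:R :> R by rewrite ltr0n; exact: graph_inhabited.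
have s0 : 0 < #|S|%:R :> R by rewrite ltr0n.
have cond : (0 < #|S|%:R / #|G|%:R :> R) && (#|S|%:R / #|G|%:R <= 2^-1 :> R).
  rewrite divr_gt0 //= ler_pdivrMr //.
  by move: S2; rewrite -(ler_nat R) -muln2 natrM; lra.
have : (psi%:E <= (#|nbhd S :\: S|%:R / #|S|%:R)%:E)%E.
  by apply: le_trans le_psi _; apply: (@bigmin_le_cond _ _ _ _ S).
by rewrite lee_fin ler_pdivlMr.
Qed.

(** The maximum with 1/2 only serves to make the factor positive. *)
Lemma expanding_contracts (R : realType) (G : graph) (psi : R) (k D : nat) :
  (forall x : G, degree x = k) -> (0 < k)%N -> (k <= D)%N -> 0 < psi ->
  @expanding R G psi ->
  contracts G (Num.max 2^-1 (1 - psi ^+ 2 / (4 * D%:R ^+ 2))).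
Proof.
move=> degG k0 kD psi0 exp f f0.
apply: le_trans (lazy_contract degG k0 psi0 exp f0) _.
apply: ler_wpM2r; first by apply: sumr_ge0 => x _; exact: sqr_ge0.
rewrite le_max lerD2l lerN2 orbC; apply/orP; left.
have kR : 0 < k%:R :> R by rewrite ltr0n.
have DR : k%:R <= D%:R :> R by rewrite ler_nat.
have D0 : 0 < D%:R :> R := lt_le_trans kR DR.
apply: ler_wpM2l; first exact: sqr_ge0.
rewrite lef_pV2 ?posrE ?mulr_gt0 ?exprn_gt0 //.
by rewrite ler_pM2l // lerXn2r ?nnegrE.
Qed.

Lemma tb_cover_from_ge (R : realType) (eps : R) (G : graph) (v : G) :
  0 <= eps -> eps <= 1 -> (1 < #|G|)%N ->
  ((#|G|.-1%:R)%:E <= tb_cover_from eps v)%E.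
Proof.
move=> eps0 eps1 G1; apply: le_ereal_inf_tmp => _ [sigma [d [T [P [X [s w ->]]]]]].
apply: (expected_cover_time_ge eps0 eps1 s _ w) => x; exact: degree_gt0.
Qed.

(** The controller always moves to the neighbour provided by the drift condition
    of the potential. *)
Lemma tb_cover_from_le (R : realType) (eps : R) (G : graph)
    (Phi : {set G} -> G -> R) (v : G) :
  0 <= eps -> eps <= 1 -> (1 < #|G|)%N -> is_cover_potential eps Phi ->
  (tb_cover_from eps v <= (Phi ([set: G] :\ v)%SET v)%:E)%E.
Proof.
move=> eps0 eps1 G1 [Phi0 PhiD].
have deg0 (x : G) : (0 < degree x)%N by exact: degree_gt0.
have ex (Ux : {set G} * G) : exists u, adj Ux.2 u /\
    ((0 < #|Ux.1|)%N -> Ux.2 \notin Ux.1 ->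
     1 + (1 - eps) * avg (fun y => Phi (Ux.1 :\ y)%SET y) Ux.2
       + eps * Phi (Ux.1 :\ u)%SET u <= Phi Ux.1 Ux.2).
  case: Ux => U x /=.
  have [/andP[U0 xU]|no] := boolP ((0 < #|U|)%N && (x \notin U)).
    by have [u xu h] := PhiD U x U0 xU; exists u.
  have /card_gt0P[u xu] := deg0 x; exists u; split => // U0 xU.
  by rewrite U0 xU in no.
have [next nextP] := choice ex.
pose sigma h u : R := (u == next (~: [set z in h], last v h))%:R.
have sigmaE h (F : G -> R) :
    \sum_u sigma h u * F u = F (next (~: [set z in h], last v h)).
  rewrite (bigD1 (next (~: [set z in h], last v h))) //= /sigma eqxx mul1r.
  by rewrite big1 ?addr0 // => u /negbTE ->; rewrite mul0r.
have s_ok : strategy sigma.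
  move=> h x; split => [u|u xu|]; first by rewrite /sigma ler0n.
    rewrite /sigma last_rcons; case: eqP => // uE.
    have [] := nextP (~: [set z in rcons h x], x); rewrite -uE /= => xu'.
    by rewrite xu' in xu.
  by have := sigmaE (rcons h x) (fun=> 1); under eq_bigr do rewrite mulr1.
have p0 := next_law_ge0 v eps0 eps1 s_ok.
have p1 := next_law_sum1 eps v s_ok deg0.
have [d [T [P [X [mX X0 XS]]]]] := realization v p0 p1.
have X_walk : is_TBRW eps sigma v P X.
  split => // t x; rewrite XS; congr (_ * _%:E)%E.
  by rewrite /next_law mkseqS last_rcons.
apply: (@le_trans _ _ (\int[P]_w cover_time R X w)%E).
  by apply: ereal_inf_lbound; exists sigma, d, T, P, X; split.
apply: (expected_cover_time_le eps0 eps1 s_ok X_walk Phi0) => h x U U0.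
rewrite next_law_sum addrA sigmaE last_rcons.
have [_ /=] := nextP (~: [set z in rcons h x], x); apply => //.
by rewrite !inE mem_rcons mem_head.
Qed.

Unset Implicit Arguments.


Theorem corollary1p4 (R : realType) (eps : R) (eps_gt0 : 0 < eps)
    (eps_le1 : eps <= 1) (G : nat -> graph)
    (G_regular : forall i, regular (G i))
    (G_bounded : exists D : nat, forall (i : nat) (x : G i), (degree x <= D)%N)
    (G_expander : expander R G) :
  exists c C : R, [/\ 0 < c, 0 < C
    & \forall i \near \oo,
        ((c * #|G i|%:R)%:E <= tb_cover eps (G i))%E /\
        (tb_cover eps (G i) <= (C * #|G i|%:R)%:E)%E].
Proof.
have [D degD] := G_bounded; have [[psi psi0 exp] Goo] := G_expander.
pose mu : R := Num.max 2^-1 (1 - psi ^+ 2 / (4 * D.+1%:R ^+ 2)).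
have mu0 : 0 < mu by rewrite lt_max invr_gt0 ltr0n.
have mu1 : mu < 1.
  by rewrite gt_max gtrBl divr_gt0 ?mulr_gt0 ?exprn_gt0 ?ltr0n // andbT; lra.
have [C C0 potential] := cover_potential_exists D.+1 mu0 mu1 eps_gt0 eps_le1.
exists 2^-1, C; split => //.
have G2 : \forall i \near \oo, (1 < #|G i|)%N.
  exact: (Goo _ (nbhs_infty_gt 1)).
apply: filterS G2 => i G1; split.
  have /card_gt0P[v _] := graph_inhabited (G i).
  apply: (@le_trans _ _ (tb_cover_from eps v)); last exact: le_bigmax.
  apply: le_trans (tb_cover_from_ge v (ltW eps_gt0) eps_le1 G1).
  (* n - 1 >= n / 2 since n > 1 *)
  rewrite lee_fin; case: #|G i| G1 => // n n1 /=.
  by move: n1; rewrite ltnS -(ler_nat R) -natr1; lra.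
have [k degk] := G_regular i.
have /card_gt0P[x0 _] := graph_inhabited (G i).
have k0 : (0 < k)%N by rewrite -(degk x0); exact: degree_gt0.
have kD : (k <= D.+1)%N by rewrite -(degk x0) (leq_trans (degD i x0)).
have gap := expanding_contracts degk k0 kD psi0 (vertex_expansion_expanding (exp i)).
have [Phi [PhiP Phi_start]] := potential (G i) k degk k0 kD gap.
apply: bigmax_le => [|v _]; first exact: leNye.
apply: le_trans (tb_cover_from_le v (ltW eps_gt0) eps_le1 G1 PhiP) _.
by rewrite lee_fin.
Qed.
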